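(* Let $(G,A,\alpha,\omega)$ be a twisted $C^*$-dynamical system, $\mathcal{E}$ a Hilbert $(G,A,\alpha,\omega)$-module and $\zeta\in\mathcal{E}_{\mathrm{si}}$ a square-integrable vector. Then ${}_2\langle\!\langle\zeta|:\mathcal{E}\to L^2(G,A)$ and $|\zeta\rangle\!\rangle_2:L^2(G,A)\to\mathcal{E}$ are morphisms of Hilbert $(G,A,\alpha,\omega)$-modules, i.e. they are adjointable and twisted-equivariant.
   Context: Twisted systems. Every locally compact Hausdorff (l.c.H.) group $G$ carries a fixed left Haar measure $\mu$ (written $dx$) with modular function $\Delta$, so $\int_G f(xr)\,dx=\Delta(r)^{-1}\int_G f(x)\,dx$. A twisted $C^*$-dynamical system $(G,A,\alpha,\omega)$ consists of an l.c.H. group $G$, a $C^*$-algebra $A$, a map $\alpha:G\to\mathrm{Aut}(A)$ with $x\mapsto\alpha_x(a)$ continuous for each $a\in A$, and a strictly continuous map $\omega:G\times G\to\mathcal{U}(M(A))$ (unitaries of the multiplier algebra; i.e. $(x,y)\mapsto\omega(x,y)a$ and $(x,y)\mapsto a\,\omega(x,y)$ are continuous for each $a$), such that, with $\overline{\alpha_r}$ the extension of $\alpha_r$ to $M(A)$: $\alpha_e=\mathrm{Id}$; $\omega(e,r)=\omega(r,e)=1$; $\overline{\alpha_r}(\overline{\alpha_s}(m))=\omega(r,s)\,\overline{\alpha_{rs}}(m)\,\omega(r,s)^*$ for $m\in M(A)$; $\overline{\alpha_r}(\omega(s,t))\,\omega(r,st)=\omega(r,s)\,\omega(rs,t)$.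 Twisted modules. Hilbert modules are right modules with inner product linear in the second variable; $\bullet$ denotes the right action, which extends canonically to $M(A)$. A Hilbert $(G,A,\alpha,\omega)$-module is a Hilbert $A$-module $\mathcal{E}$ with a strongly continuous map $\gamma^{\mathcal{E}}$ from $G$ to the linear isometries of $\mathcal{E}$ (a twisted action) such that $\gamma^{\mathcal{E}}_e=\mathrm{Id}$, $\gamma^{\mathcal{E}}_r(\zeta\bullet a)=\gamma^{\mathcal{E}}_r(\zeta)\bullet\alpha_r(a)$, $\langle\gamma^{\mathcal{E}}_r(\zeta)|\gamma^{\mathcal{E}}_r(\eta)\rangle=\alpha_r(\langle\zeta|\eta\rangle)$, $\gamma^{\mathcal{E}}_r(\gamma^{\mathcal{E}}_s(\zeta))=\gamma^{\mathcal{E}}_{rs}(\zeta)\bullet\omega(r,s)^*$. Morphisms $\mathcal{E}\to\mathcal{F}$ are adjointable operators $T$ that are twisted-equivariant: $T\circ\gamma^{\mathcal{E}}_r=\gamma^{\mathcal{F}}_r\circ T$ for all $r\in G$. Standard module. $L^2(G,A)$ is the Hilbert $A$-module obtained by completing $C_c(G,A)$ in the norm $\|\int_G\phi(x)^*\phi(x)\,dx\|_A^{1/2}$, with inner product $\int_G\phi(x)^*\psi(x)\,dx$ and right action $(\phi\bullet a)(x)=\phi(x)a$; $q:C_c(G,A)\to L^2(G,A)$ is the canonical embedding. Its twisted action $\Gamma$ is determined by $\Gamma_r(q(\phi))=q\big(x\mapsto\omega(r,r^{-1}x)^*\alpha_r(\phi(r^{-1}x))\big)$. Square-integrability. For $\zeta,\eta\in\mathcal{E}$,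 $\phi\in C_c(G,A)$, put $\langle\!\langle\zeta|(\eta)=\big(x\mapsto\langle\gamma^{\mathcal{E}}_x(\zeta)|\eta\rangle\big)\in C_b(G,A)$ and $|\zeta\rangle\!\rangle(\phi)=\int_G\gamma^{\mathcal{E}}_x(\zeta)\bullet\phi(x)\,dx\in\mathcal{E}$. The vector $\zeta$ is square-integrable if for every $\eta\in\mathcal{E}$ and every net $(\varphi_i)$ in $C_c(G,[0,1])$ converging to $1$ uniformly on compact subsets of $G$, the net $(q(\varphi_i\cdot\langle\!\langle\zeta|(\eta)))_i$ is Cauchy in $L^2(G,A)$; then ${}_2\langle\!\langle\zeta|(\eta)$ denotes its limit, which does not depend on the net. $\mathcal{E}_{\mathrm{si}}$ is the linear subspace of square-integrable vectors. For $\zeta\in\mathcal{E}_{\mathrm{si}}$, $|\zeta\rangle\!\rangle_2:L^2(G,A)\to\mathcal{E}$ denotes the unique operator with adjoint ${}_2\langle\!\langle\zeta|$ satisfying $|\zeta\rangle\!\rangle_2(q(\phi))=|\zeta\rangle\!\rangle(\phi)$ for all $\phi\in C_c(G,A)$. *)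

(* Defs.v *)
From HB Require Import structures.
From mathcomp Require Import all_boot all_order all_algebra.
From mathcomp Require Import all_classical all_reals all_analysis.
From mathcomp Require Export complex.

Set Implicit Arguments.
Unset Strict Implicit.
Unset Printing Implicit Defensive.

Import Order.TTheory GRing.Theory Num.Theory.
Import numFieldNormedType.Exports.

Local Open Scope classical_set_scope.
Local Open Scope ring_scope.
Local Open Scope complex_scope.

HB.mixin Record isLCHGroup G & Group G & Topological G := {
  mulg_continuous : continuous (fun p : G * G => (p.1 * p.2)%g);
  invg_continuous : continuous (fun x : G => x^-1%g);
  lchg_hausdorff : hausdorff_space G;
  lchg_locally_compact : locally_compact [set: G] }.

#[short(type="lchGroupType")]
HB.structure Definition LCHGroup :=
  { G of isLCHGroup G & Group G & Topological G }.

(* [g_sigma_algebraType] asks for a pointed type; the point is the unit.      *)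
Definition pointed_group (G : lchGroupType) : Type := G.
HB.instance Definition _ (G : lchGroupType) := Choice.on (pointed_group G).
HB.instance Definition _ (G : lchGroupType) :=
  isPointed.Build (pointed_group G) (1%g : G).

Definition borel_type (G : lchGroupType) :=
  g_sigma_algebraType (@open G : set (set (pointed_group G))).

Record left_haar (R : realType) (G : lchGroupType)
    (mu : {measure set (borel_type G) -> \bar R}) : Prop := LeftHaar {
  haar_compact : forall K : set G, compact K -> (mu K < +oo)%E;
  haar_outer : forall B : set G, measurable (B : set (borel_type G)) ->
    mu B = ereal_inf [set mu U | U in [set U : set G | open U /\ B `<=` U]];
  haar_inner : forall U : set G, open U ->
    mu U = ereal_sup [set mu K | K in [set K : set G | compact K /\ K `<=` U]];
  haar_neq0 : mu [set: G] != 0%E;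
  haar_invariant : forall (x : G) (B : set G),
    measurable (B : set (borel_type G)) ->
    mu [set (x * y)%g | y in B] = mu B }.

(* The norm of a normed [R[i]]-module takes its values in [R[i]]; it is       *)
(* always real, and [rnorm] is the corresponding element of [R].              *)
Definition rnorm (R : realType) (V : normedModType R[i]) (v : V) : R :=
  complex.Re `|v|.

(* Bochner integral: [v] is the integral of [f] if [f] can be approximated    *)
(* in L^1-distance by integrable simple functions whose integrals approach v. *)
Definition is_bochner (R : realType) (G : lchGroupType)
    (mu : {measure set (borel_type G) -> \bar R})
    (V : normedModType R[i]) (f : G -> V) (v : V) : Prop :=
  forall e : R, 0 < e ->
  exists (n : nat) (B : 'I_n -> set (borel_type G)) (c : 'I_n -> V),
    let dist := fun x : borel_type G =>
      (rnorm (f x - \sum_(k < n) (\1_(B k) x : R)%:C *: c k))%:E in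
    [/\ forall k, measurable (B k) /\ (mu (B k) < +oo)%E,
        mu.-integrable setT dist,
        (\int[mu]_x dist x <= e%:E)%E
      & rnorm (v - \sum_(k < n) (fine (mu (B k)))%:C *: c k) <= e].

Definition bochner (R : realType) (G : lchGroupType)
    (mu : {measure set (borel_type G) -> \bar R})
    (V : normedModType R[i]) (f : G -> V) : V :=
  xget 0 [set v | is_bochner mu f v].

Definition Cc (G : topologicalType) (V : PreTopologicalZmodule.type) (f : G -> V) :=
  continuous f /\ compact (closure [set x | f x != 0]).

(* No unit is assumed.                                                        *)
HB.mixin Record isCStarAlgebra (R : realType) A
    & CompleteNormedModule R[i] A := {
  cmul : A -> A -> A;
  cstar : A -> A;
  cmulA : associative cmul;
  cmulDl : left_distributive cmul +%R;
  cmulDr : right_distributive cmul +%R;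
  cmulZl : forall (k : R[i]) a b, cmul (k *: a) b = k *: cmul a b;
  cmulZr : forall (k : R[i]) a b, cmul a (k *: b) = k *: cmul a b;
  cnorm_mul : forall a b : A, `|cmul a b| <= `|a| * `|b|;
  cstarK : involutive cstar;
  cstarD : {morph cstar : a b / a + b};
  cstarZ : forall (k : R[i]) a, cstar (k *: a) = k^*%C *: cstar a;
  cstarM : forall a b, cstar (cmul a b) = cmul (cstar b) (cstar a);
  cnorm_star : forall a : A, `|cmul (cstar a) a| = `|a| ^+ 2 }.

#[short(type="cstarAlgType")]
HB.structure Definition CStarAlgebra (R : realType) :=
  { A of isCStarAlgebra R A & CompleteNormedModule R[i] A }.

Declare Scope cstar_scope.
Delimit Scope cstar_scope with cstar.
Local Open Scope cstar_scope.
Notation "a ** b" := (cmul a b) (at level 40, left associativity) : cstar_scope.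
Notation "a ^#" := (cstar a) (at level 2, format "a ^#")
  : cstar_scope.

(* M(A) as the algebra of double centralizers.  Linearity and boundedness of  *)
(* both maps follow from [multP], since [A] is a C*-algebra.                  *)
Record multiplier (R : realType) (A : cstarAlgType R) := Multiplier {
  lmult : A -> A;
  rmult : A -> A;
  multP : forall a b, a ** lmult b = rmult a ** b }.

Section Multipliers.
Variables (R : realType) (A : cstarAlgType R).
Implicit Types m n : multiplier A.

Lemma mult1_subproof (a b : A) : a ** id b = id a ** b.
Proof. by []. Qed.
Definition mult1 : multiplier A := Multiplier mult1_subproof.

Lemma multM_subproof m n (a b : A) :
  a ** (lmult m \o lmult n) b = (rmult n \o rmult m) a ** b.
Proof. by rewrite /= !multP. Qed.
Definition multM m n : multiplier A := Multiplier (multM_subproof m n).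

Lemma mult_adj_subproof m (a b : A) :
  a ** (rmult m b^#)^# = (lmult m a^#)^# ** b.
Proof. by rewrite -[a in LHS]cstarK -cstarM -multP cstarM cstarK. Qed.
Definition mult_adj m : multiplier A :=
  @Multiplier R A (fun a => (rmult m a^#)^#) (fun a => (lmult m a^#)^#)
    (mult_adj_subproof m).

Definition mult_unitary m : Prop :=
  multM (mult_adj m) m = mult1 /\ multM m (mult_adj m) = mult1.

End Multipliers.

Record cstar_aut (R : realType) (A : cstarAlgType R) := CstarAut {
  aut_fun :> A -> A;
  aut_inv : A -> A;
  aut_funK : cancel aut_fun aut_inv;
  aut_invK : cancel aut_inv aut_fun;
  aut_linear : linear aut_fun;
  aut_mul : {morph aut_fun : a b / a ** b};
  aut_star : {morph aut_fun : a / a^#} }.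

Section Extension.
Variables (R : realType) (A : cstarAlgType R) (f : cstar_aut A).

Lemma aut_ext_subproof (m : multiplier A) (a b : A) :
  a ** f (lmult m (aut_inv f b)) = f (rmult m (aut_inv f a)) ** b.
Proof. by rewrite -{1}(aut_invK f a) -aut_mul multP aut_mul aut_invK. Qed.

(* The extension of [f] to M(A), determined by f(m) f(a) = f(m a).            *)
Definition aut_ext (m : multiplier A) : multiplier A :=
  Multiplier (aut_ext_subproof m).

End Extension.

Record twisted_system (R : realType) (G : lchGroupType) (A : cstarAlgType R) :=
  TwistedSystem {
    alpha : G -> cstar_aut A;
    omega : G -> G -> multiplier A;
    alpha_continuous : forall a : A, continuous (fun x : G => alpha x a);
    omega_unitary : forall r s, mult_unitary (omega r s);
    omega_continuousl : forall a : A,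
      continuous (fun p : G * G => lmult (omega p.1 p.2) a);
    omega_continuousr : forall a : A,
      continuous (fun p : G * G => rmult (omega p.1 p.2) a);
    alpha1g : forall a : A, alpha 1%g a = a;
    omega1g : forall r, omega 1%g r = mult1 A;
    omegag1 : forall r, omega r 1%g = mult1 A;
    alphaM : forall r s (m : multiplier A),
      aut_ext (alpha r) (aut_ext (alpha s) m) =
      multM (multM (omega r s) (aut_ext (alpha (r * s)%g) m))
            (mult_adj (omega r s));
    omegaM : forall r s t,
      multM (aut_ext (alpha r) (omega s t)) (omega r (s * t)%g) =
      multM (omega r s) (omega (r * s)%g t) }.

(* Positivity of <x,x> in A is expressed as <x,x> = b^* b; definiteness of    *)
(* the inner product is contained in [hnormE].                                *)
HB.mixin Record isHilbertModule (R : realType) (A : cstarAlgType R) E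
    & CompleteNormedModule R[i] E := {
  hact : E -> A -> E;
  hinner : E -> E -> A;
  hactDl : forall x y a, hact (x + y) a = hact x a + hact y a;
  hactDr : forall x a b, hact x (a + b) = hact x a + hact x b;
  hactZl : forall (k : R[i]) x a, hact (k *: x) a = k *: hact x a;
  hactZr : forall (k : R[i]) x a, hact x (k *: a) = k *: hact x a;
  hactA : forall x a b, hact (hact x a) b = hact x (a ** b);
  hinnerDr : forall x y z, hinner x (y + z) = hinner x y + hinner x z;
  hinnerZr : forall (k : R[i]) x y, hinner x (k *: y) = k *: hinner x y;
  hinner_act : forall x y a, hinner x (hact y a) = hinner x y ** a;
  hinner_star : forall x y, (hinner x y)^# = hinner y x;
  hinner_ge0 : forall x, exists b : A, hinner x x = b^# ** b;
  hnormE : forall x : E, `|x| ^+ 2 = `|hinner x x| }.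

#[short(type="hilbertModType")]
HB.structure Definition HilbertModule (R : realType) (A : cstarAlgType R) :=
  { E of isHilbertModule R A E & CompleteNormedModule R[i] E }.

Notation "x <.> a" := (hact x a) (at level 40, left associativity)
  : cstar_scope.
Notation "<{ x | y }>" := (hinner x y) (at level 0, x at level 69,
  y at level 69, format "<{ x  |  y }>") : cstar_scope.

(* [is_mact x m y]: y is the value of the canonical extension of the right    *)
(* action to M(A) at (x, m), i.e. the only vector with y a = x (m a) for all  *)
(* a in A.                                                                    *)
Definition is_mact (R : realType) (A : cstarAlgType R) (E : hilbertModType A)
    (x : E) (m : multiplier A) (y : E) : Prop :=
  forall a : A, y <.> a = x <.> lmult m a.

Record twisted_module (R : realType) (G : lchGroupType) (A : cstarAlgType R)
    (S : twisted_system G A) := TwistedModule {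
  tm_module :> hilbertModType A;
  gamma : G -> tm_module -> tm_module;
  gamma_continuous : forall z, continuous (fun r : G => gamma r z);
  gamma_linear : forall r, linear (gamma r);
  gamma_isometry : forall r z, `|gamma r z| = `|z|;
  gamma1g : forall z, gamma 1%g z = z;
  gamma_act : forall r z a, gamma r (z <.> a) = gamma r z <.> alpha S r a;
  gamma_inner : forall r x y, <{gamma r x | gamma r y}> = alpha S r <{x | y}>;
  gammaM : forall r s z,
    is_mact (gamma (r * s)%g z) (mult_adj (omega S r s)) (gamma r (gamma s z)) }.
Arguments gamma {R G A S} t _ _.

Definition adjoint_of (R : realType) (A : cstarAlgType R)
    (E F : hilbertModType A) (T : E -> F) (T' : F -> E) : Prop :=
  forall x y, <{T x | y}> = <{x | T' y}>.

Definition adjointable (R : realType) (A : cstarAlgType R)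
    (E F : hilbertModType A) (T : E -> F) : Prop :=
  exists T' : F -> E, adjoint_of T T'.

Definition twisted_equivariant (R : realType) (G : lchGroupType)
    (A : cstarAlgType R) (S : twisted_system G A) (E F : twisted_module S)
    (T : E -> F) : Prop :=
  forall r x, T (gamma E r x) = gamma F r (T x).

Definition is_twisted_morphism (R : realType) (G : lchGroupType)
    (A : cstarAlgType R) (S : twisted_system G A) (E F : twisted_module S)
    (T : E -> F) : Prop :=
  adjointable T /\ twisted_equivariant T.

(* L^2(G,A): a completion of C_c(G,A), i.e. a (complete) Hilbert A-module with *)
(* a dense copy of C_c(G,A) carrying the prescribed inner product, action and *)
(* twisted action.  The values of [L2_q] outside of C_c(G,A) are irrelevant.  *)
Record L2_module (R : realType) (G : lchGroupType)
    (mu : {measure set (borel_type G) -> \bar R}) (A : cstarAlgType R)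
    (S : twisted_system G A) := L2Module {
  L2_twisted :> twisted_module S;
  L2_q : (G -> A) -> L2_twisted;
  L2_qD : forall (k : R[i]) (f g : G -> A), Cc f -> Cc g ->
    L2_q (fun x => k *: f x + g x) = k *: L2_q f + L2_q g;
  L2_q_inner : forall f g : G -> A, Cc f -> Cc g ->
    <{L2_q f | L2_q g}> = bochner mu (fun x => (f x)^# ** g x);
  L2_q_act : forall (f : G -> A) (a : A), Cc f ->
    L2_q f <.> a = L2_q (fun x => f x ** a);
  L2_q_dense : closure [set L2_q f | f in [set f : G -> A | Cc f]] = setT;
  L2_gamma : forall (r : G) (f : G -> A), Cc f ->
    gamma L2_twisted r (L2_q f) =
    L2_q (fun x => lmult (mult_adj (omega S r (r^-1 * x)%g))
                         (alpha S r (f (r^-1 * x)%g))) }.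
Arguments L2_q {R G mu A S} l _.

Record cutoff_net (R : realType) (G : lchGroupType) := CutoffNet {
  net_index : Type;
  net_le : net_index -> net_index -> Prop;
  net_inhabited : inhabited net_index;
  net_refl : forall i, net_le i i;
  net_trans : forall i j k, net_le i j -> net_le j k -> net_le i k;
  net_directed : forall i j, exists k, net_le i k /\ net_le j k;
  net_fun :> net_index -> G -> R;
  net_Cc : forall i, Cc (net_fun i);
  net_01 : forall i x, 0 <= net_fun i x <= 1;
  net_cvg1 : forall K : set G, compact K -> forall e : R, 0 < e ->
    exists i0, forall i, net_le i0 i ->
    forall x, K x -> `|net_fun i x - 1| < e }.

Definition net_filter (R : realType) (G : lchGroupType) (N : cutoff_net R G)
    : set_system (net_index N) :=
  [set P | exists i0, forall i, net_le i0 i -> P i].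
Arguments net_filter {R G} N _.

Section SquareIntegrable.
Variables (R : realType) (G : lchGroupType).
Variables (mu : {measure set (borel_type G) -> \bar R}).
Variables (A : cstarAlgType R) (S : twisted_system G A).
Variables (L : L2_module mu S) (E : twisted_module S).

Definition bra (z y : E) (x : G) : A := <{gamma E x z | y}>.

Definition ket (z : E) (f : G -> A) : E :=
  bochner mu (fun x => gamma E x z <.> f x).

Definition cut_bra (z y : E) (N : cutoff_net R G) (i : net_index N) : L :=
  L2_q L (fun x => (N i x)%:C *: bra z y x).
Arguments cut_bra : clear implicits.

Definition square_integrable (z : E) : Prop :=
  forall (y : E) (N : cutoff_net R G),
    cauchy (cut_bra z y N @ net_filter N).

(* [bra z], [ket z], [bra2 z] and [ket2 z] are the four operators attached to *)
(* z, the last two having L^2(G,A) as codomain and domain.  [bra2] and [ket2] *)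
(* are definite descriptions: the default value 0 is only taken when no       *)
(* object with the defining property exists.                                  *)
Definition bra2 (z y : E) : L :=
  xget 0 [set l : L | forall N : cutoff_net R G,
            cut_bra z y N @ net_filter N --> l].

Definition ket2 (z : E) : L -> E :=
  xget (fun=> 0) [set T : L -> E | adjoint_of T (bra2 z) /\
    forall f : G -> A, Cc f -> T (L2_q L f) = ket z f].

End SquareIntegrable.
Arguments cut_bra {R G mu A S} L {E} z y N _.
Arguments ket2 {R G mu A S} L {E} z _.

(* Main.v *)
Require Import Defs.
From HB Require Import structures.
From mathcomp Require Import all_boot all_order all_algebra.
From mathcomp Require Import all_classical all_reals all_analysis.
From mathcomp Require Import measurable_realfun.
From mathcomp Require Import ring lra.

(** Everything follows from one formula: for y in E and f in C_c(G,A),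

      <bra2 y | q f> = <y | ket f>,

    where both sides are the integral of bra(y)^* f ([cut_bra_pairing],
    [cut_bra_lim], [hinner_bra2]).  On the right the inner product with y is a
    bounded linear map, hence passes under the Bochner integral.  On the left the
    cutoffs phi_i tend to 1 uniformly on the support of f, so the integrals of
    (phi_i bra(y))^* f tend to that of bra(y)^* f.  As q(C_c(G,A)) is dense, the
    formula determines the limit of the net, which is therefore independent of
    the net; since G is locally compact Hausdorff, there is at least one net.

    Adjointability.  Call (l, v) an adjoint pair if <y | v> = <bra2 y | l>
    for all y.  By the formula (q f, ket f) is such a pair.  The vectors v of the
    adjoint pairs with |l| <= 1 are weakly bounded, by a multiple of |bra2 y| for
    each y, hence norm bounded by the uniform boundedness principle
    ([weakly_bounded]).  So |v| <= C |l| for all adjoint pairs, and completeness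
    extends the partial map l |-> v from the dense subspace q(C_c(G,A)) to all
    of L^2(G,A) ([adj_pair_total]).  The result is the operator ket2, adjoint to
    bra2.

    Equivariance.  The action Gamma_r sends the vector that defines bra2 y with a
    net phi_i to the one that defines bra2 (gamma_r y) with the net
    phi_i(r^-1 x); the latter is again a net of cutoffs, so in the limit
    Gamma_r (bra2 y) = bra2 (gamma_r y) ([bra2_gamma]).  The equivariance of ket2
    follows by taking adjoints, since the range of gamma_r is large enough to
    separate vectors ([gamma_sep]).

    The role of the Cauchy-Schwarz inequality is played by
    |<x | y>| <= 6 |x| |y|, which polarization yields from the triangle
    inequality of the module ([rnorm_hinner]). *)

Set Implicit Arguments.
Unset Strict Implicit.
Unset Printing Implicit Defensive.

Import Order.TTheory GRing.Theory Num.Theory.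
Import numFieldNormedType.Exports.

Local Open Scope classical_set_scope.
Local Open Scope ring_scope.
Local Open Scope complex_scope.
Local Open Scope cstar_scope.

(** * The real-valued norm of a complex normed space *)

Section RealNorm.
Variables (R : realType) (V : normedModType R[i]).
Implicit Types (x y z : V) (e : R).

Lemma rnormE x : `|x| = (rnorm x)%:C.
Proof. by rewrite /rnorm RRe_real // ger0_real. Qed.

Lemma rnorm_ge0 x : 0 <= rnorm x.
Proof. by rewrite -ler0c -rnormE. Qed.

Lemma rnorm0 : rnorm (0 : V) = 0.
Proof. by rewrite /rnorm normr0. Qed.

Lemma rnorm_eq0 x : rnorm x = 0 -> x = 0.
Proof. by move=> h; apply/eqP; rewrite -normr_eq0 rnormE h. Qed.

Lemma rnormN x : rnorm (- x) = rnorm x.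
Proof. by rewrite /rnorm normrN. Qed.

Lemma rnormB x y : rnorm (x - y) = rnorm (y - x).
Proof. by rewrite /rnorm distrC. Qed.

Lemma rnormD x y : rnorm (x + y) <= rnorm x + rnorm y.
Proof. by rewrite -lecR rmorphD /= -!rnormE ler_normD. Qed.

Lemma rnorm_dist x y z : rnorm (x - z) <= rnorm (x - y) + rnorm (y - z).
Proof. by rewrite (le_trans _ (rnormD _ _))// addrA subrK. Qed.

Lemma ler_rnormB x y : rnorm x - rnorm y <= rnorm (x - y).
Proof. by rewrite lerBlDr -{1}(subrK y x) rnormD. Qed.

Lemma rnormZ (k : R[i]) x : rnorm (k *: x) = complex.Re `|k| * rnorm x.
Proof.
apply: complexI; rewrite -rnormE normrZ rnormE rmorphM /=.
by rewrite RRe_real // ger0_real.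
Qed.

Lemma rnormZr (k : R) x : rnorm (k%:C *: x) = `|k| * rnorm x.
Proof. by rewrite rnormZ normc_def /= expr0n addr0 sqrtr_sqr. Qed.

(** The topology of a normed space over the complex numbers is described by radii
    in [R[i]]; a positive element of [R[i]] is real, so real radii suffice. *)
Lemma nbhs_rnormP x (P : set V) :
  nbhs x P <-> exists2 e, 0 < e & forall y, rnorm (x - y) < e -> P y.
Proof.
split=> [/nbhs_normP[e /= e0 eP]|[e e0 eP]]; last first.
  apply/nbhs_normP; exists e%:C => /=; first by rewrite ltcR.
  by move=> y /=; rewrite rnormE ltcR; exact: eP.
have eE : e = (complex.Re e)%:C by rewrite RRe_real // gtr0_real.
exists (complex.Re e); first by rewrite -ltcR -eE.
by move=> y xy; apply: eP => /=; rewrite eE rnormE ltcR.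
Qed.

Lemma cvg_rnormP (T : Type) (F : set_system T) (FF : Filter F) (f : T -> V) x :
  f @ F --> x <-> forall e, 0 < e -> \forall t \near F, rnorm (x - f t) < e.
Proof.
split=> [fx e e0|H P].
  by apply: (fx [set y | rnorm (x - y) < e]); apply/nbhs_rnormP; exists e.
move=> /nbhs_rnormP[e e0 eP]; have := H e e0.
by apply: filterS => t; exact: eP.
Qed.

Lemma continuous_rnormP (T : topologicalType) (f : T -> V) :
  continuous f <->
  forall t e, 0 < e -> \forall u \near t, rnorm (f t - f u) < e.
Proof.
by split=> [cf t|H t]; apply/(cvg_rnormP (nbhs_filter t) f (f t));
  [exact: cf|exact: H].
Qed.

Lemma cauchy_rnormP (T : Type) (F : set_system T) (FF : ProperFilter F)
    (f : T -> V) :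
  cauchy (f @ F) <->
  forall e, 0 < e -> exists x, \forall t \near F, rnorm (x - f t) < e.
Proof.
split.
  move=> /cauchyP H e e0.
  have [|x xe] := H e%:C; first by rewrite ltcR.
  exists x; apply: (@filterS _ F _ _ _ _ xe) => t.
  by rewrite /= -ball_normE /= rnormE ltcR.
move=> H; apply: cauchy_exP => e e0.
have eE : e = (complex.Re e)%:C by rewrite RRe_real // gtr0_real.
have [|x xe] := H (complex.Re e); first by rewrite -ltcR -eE.
exists x; apply: (@filterS _ F _ _ _ _ xe) => t h.
by rewrite /= -ball_normE /= rnormE eE ltcR.
Qed.

End RealNorm.

Lemma continuous_realZ (R : realType) (V : normedModType R[i])
   (T : topologicalType) (k : T -> R) (f : T -> V) :
  continuous k -> continuous f -> continuous (fun t => (k t)%:C *: f t).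
Proof.
move=> ck cf; apply/continuous_rnormP => t e e0.
have M0 : 0 < `|k t| + rnorm (f t) + 1.
  by rewrite ltr_wpDl // addr_ge0 // rnorm_ge0.
set M := _ + 1 in M0.
have d0 : 0 < Num.min 1 (e / (2 * M)).
  by rewrite lt_min ltr01 divr_gt0 // mulr_gt0.
near=> u.
have ku : `|k t - k u| < Num.min 1 (e / (2 * M)).
  by near: u; have /cvgrPdist_lt := ck t; apply.
have fu : rnorm (f t - f u) < Num.min 1 (e / (2 * M)).
  by near: u; move/continuous_rnormP : cf; apply.
have -> : (k t)%:C *: f t - (k u)%:C *: f u =
    (k t - k u)%:C *: f t + (k u)%:C *: (f t - f u).
  by rewrite rmorphB scalerBl scalerBr addrA subrK.
apply: (le_lt_trans (rnormD _ _)); rewrite !rnormZr.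
move: ku fu; rewrite !lt_min => /andP[ku1 ku] /andP[_ fu].
have kuM : `|k u| <= `|k t| + 1.
  by rewrite -[k u](subKr (k t)) (le_trans (ler_normB _ _))// lerD2l ltW.
have eM : e = e / (2 * M) * M + e / (2 * M) * M.
  by field; rewrite gt_eqF.
rewrite eM; apply: ler_ltD.
- apply: ler_pM; [exact: normr_ge0|exact: rnorm_ge0|exact: ltW|].
  by rewrite /M -addrA ler_wpDl // lerDl.
rewrite mulrC; apply: (@le_lt_trans _ _ (rnorm (f t - f u) * M)).
  apply: ler_wpM2l; first exact: rnorm_ge0.
  by rewrite (le_trans kuM) // /M -addrA lerD2l lerDr rnorm_ge0.
by rewrite ltr_pM2r.
Unshelve. all: by end_near. Qed.

(** Completeness in quantitative form: a bound on the tails of a Cauchy sequence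
    is inherited by the distance to the limit. *)
Lemma complete_seq (R : realType) (V : completeNormedModType R[i])
    (x : nat -> V) (a : nat -> R) :
  (forall n m, (n <= m)%N -> rnorm (x m - x n) <= a n) ->
  (forall e, 0 < e -> exists n, a n < e) ->
  exists l, forall n, rnorm (l - x n) <= a n.
Proof.
move=> xa a0.
have xcau : cauchy (x @ \oo).
  apply/cauchy_rnormP => e /a0[n an]; exists (x n); near=> m.
  rewrite rnormB (le_lt_trans _ an) // xa //; near: m; exact: nbhs_infty_ge.
have /cvg_rnormP xl : x @ \oo --> lim (x @ \oo) by exact: cauchy_cvg.
exists (lim (x @ \oo)) => n; apply/ler_addgt0Pr => e e0.
have [m _ mP] := xl e e0.
have := mP (maxn m n) (leq_maxl _ _) => /ltW xm.
apply: (le_trans (rnorm_dist _ (x (maxn m n)) _)); rewrite addrC.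
by apply: lerD => //; exact/xa/leq_maxr.
Unshelve. all: by end_near. Qed.

(** * C*-algebras, Hilbert modules and twisted modules *)

Section CStarAlgebra.
Variables (R : realType) (A : cstarAlgType R).
Implicit Types a b : A.

Lemma cmulNr a b : a ** (- b) = - (a ** b).
Proof. by rewrite -scaleN1r cmulZr scaleN1r. Qed.

Lemma cmulBr a b c : a ** (b - c) = a ** b - a ** c.
Proof. by rewrite cmulDr cmulNr. Qed.

Lemma cstarN a : (- a)^# = - a^#.
Proof. by rewrite -scaleN1r cstarZ rmorphN rmorph1 scaleN1r. Qed.

Lemma cstarB a b : (a - b)^# = a^# - b^#.
Proof. by rewrite cstarD cstarN. Qed.

Lemma rnorm_cmul a b : rnorm (a ** b) <= rnorm a * rnorm b.
Proof. by rewrite -lecR rmorphM /= -!rnormE cnorm_mul. Qed.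

Lemma rnorm_cstar_mul a : rnorm (a^# ** a) = rnorm a ^+ 2.
Proof. by apply: complexI; rewrite rmorphXn /= -!rnormE cnorm_star. Qed.

(** |a|^2 = |a^* a| <= |a^*| |a| gives |a| <= |a^*|; apply this to a^* as well. *)
Lemma rnorm_cstar a : rnorm a^# = rnorm a.
Proof.
have le b : rnorm b <= rnorm b^#.
  have [->|b0] := eqVneq (rnorm b) 0; first exact: rnorm_ge0.
  rewrite -(ler_pM2r (x := rnorm b)); last by rewrite lt_def b0 rnorm_ge0.
  by rewrite -expr2 -rnorm_cstar_mul rnorm_cmul.
by apply/le_anti; rewrite le andbT -{2}(cstarK a) le.
Qed.

(** A C*-algebra without unit still acts faithfully on itself: test with b^*. *)
Lemma cmul_eq0 b : (forall a, a ** b = 0) -> b = 0.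
Proof.
move=> /(_ b^#) bb; apply: rnorm_eq0; apply/eqP.
by rewrite -sqrf_eq0 -rnorm_cstar_mul bb rnorm0.
Qed.

Lemma cmul_inj b c : (forall a, a ** b = a ** c) -> b = c.
Proof.
move=> bc; apply/eqP; rewrite -subr_eq0; apply/eqP/cmul_eq0 => a.
by rewrite cmulBr bc subrr.
Qed.

Lemma lmultZ (m : multiplier A) (k : R[i]) (a : A) :
  lmult m (k *: a) = k *: lmult m a.
Proof. by apply: cmul_inj => b; rewrite multP !cmulZr multP. Qed.

Lemma unitary_lmultK (m : multiplier A) (a : A) :
  mult_unitary m -> lmult (mult_adj m) (lmult m a) = a.
Proof. by case=> /(congr1 (@lmult R A)) /(congr1 (@^~ a)). Qed.

Lemma cstar_lmult_adj (m : multiplier A) (a : A) :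
  (lmult (mult_adj m) a)^# = rmult m a^#.
Proof. by rewrite /= cstarK. Qed.

End CStarAlgebra.

Section HilbertModule.
Variables (R : realType) (A : cstarAlgType R) (E : hilbertModType A).
Implicit Types (x y z : E) (a : A).

Lemma hinner0r x : <{x | (0 : E)}> = 0.
Proof. by rewrite -[X in <{_ | X}>](scale0r (0 : E)) hinnerZr scale0r. Qed.

Lemma hinnerNr x y : <{x | - y}> = - <{x | y}>.
Proof. by rewrite -scaleN1r hinnerZr scaleN1r. Qed.

Lemma hinnerBr x y z : <{x | y - z}> = <{x | y}> - <{x | z}>.
Proof. by rewrite hinnerDr hinnerNr. Qed.

Lemma hinnerDl x y z : <{x + y | z}> = <{x | z}> + <{y | z}>.
Proof. by rewrite -hinner_star hinnerDr cstarD !hinner_star. Qed.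

Lemma hinnerZl k x y : <{k *: x | y}> = k^*%C *: <{x | y}>.
Proof. by rewrite -hinner_star hinnerZr cstarZ !hinner_star. Qed.

Lemma hinnerBl x y z : <{x - y | z}> = <{x | z}> - <{y | z}>.
Proof. by rewrite -hinner_star hinnerBr cstarB !hinner_star. Qed.

Lemma hinner_actl x a y : <{x <.> a | y}> = a^# ** <{x | y}>.
Proof. by rewrite -hinner_star hinner_act cstarM !hinner_star. Qed.

Lemma rnorm_hinnerxx x : rnorm <{x | x}> = rnorm x ^+ 2.
Proof. by apply: complexI; rewrite rmorphXn /= -!rnormE hnormE. Qed.

Lemma hinner_sep y : (forall x, <{x | y}> = 0) -> y = 0.
Proof.
move=> /(_ y) yy; apply: rnorm_eq0; apply/eqP.
by rewrite -sqrf_eq0 -rnorm_hinnerxx yy rnorm0.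
Qed.

Lemma hinner_inj y z : (forall x, <{x | y}> = <{x | z}>) -> y = z.
Proof.
move=> yz; apply/eqP; rewrite -subr_eq0; apply/eqP/hinner_sep => x.
by rewrite hinnerBr yz subrr.
Qed.

Lemma rnorm_hact x a : rnorm (x <.> a) <= rnorm x * rnorm a.
Proof.
rewrite -(@ler_pXn2r _ 2) ?nnegrE ?mulr_ge0 ?rnorm_ge0 //.
rewrite -rnorm_hinnerxx hinner_act hinner_actl exprMn -rnorm_hinnerxx.
apply: (le_trans (rnorm_cmul _ _)); rewrite expr2 mulrA ler_wpM2r ?rnorm_ge0 //.
by rewrite (le_trans (rnorm_cmul _ _)) // rnorm_cstar mulrC.
Qed.

(** For unit vectors, <u|v> + <v|u> is the difference of <u+v|u+v> and
    <u|u> + <v|v>, of norm at most 2^2 + 1 + 1 = 6 by the triangle inequality.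
    Half of this term minus i/2 times its analogue for u and i v is <u|v>. *)
Lemma rnorm_hinner x y : rnorm <{x | y}> <= 6 * (rnorm x * rnorm y).
Proof.
have herm (u v : E) : rnorm u = 1 -> rnorm v = 1 ->
    rnorm (<{u | v}> + <{v | u}>) <= 6.
  move=> u1 v1.
  have -> : <{u | v}> + <{v | u}> = <{u + v | u + v}> - <{u | u}> - <{v | v}>.
    rewrite hinnerDl !hinnerDr [in RHS]addrAC [X in _ = X - _ - _]addrA addrK.
    by rewrite [RHS]addrC !addrA addNr add0r.
  apply: (le_trans (rnormD _ _)); rewrite rnormN.
  apply: (le_trans (lerD (rnormD _ _) (lexx _))).
  rewrite rnormN !rnorm_hinnerxx u1 v1.
  have : rnorm (u + v) ^+ 2 <= 2 ^+ 2.
    by rewrite ler_pXn2r ?nnegrE ?rnorm_ge0 // (le_trans (rnormD _ _)) // u1 v1.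
  by lra.
have unit (u v : E) : rnorm u = 1 -> rnorm v = 1 -> rnorm <{u | v}> <= 6.
  move=> u1 v1.
  have ci : 'i^*%C = - 'i :> R[i] by simpc.
  have e2 : 2%:C *: <{u | v}> =
      (<{u | v}> + <{v | u}>) - 'i *: (<{u | 'i *: v}> + <{'i *: v | u}>).
    rewrite hinnerZr hinnerZl ci scalerDr !scalerA mulrN -expr2 sqr_i opprK.
    rewrite scale1r scaleN1r opprD opprK addrACA subrr addr0.
    by rewrite rmorph_nat scaler_nat mulr2n.
  have iv : rnorm ('i *: v) = 1.
    by rewrite rnormZ normc_def /= expr0n expr1n add0r sqrtr1 mul1r.
  rewrite -(ler_pM2l (x := 2)) // -[X in X * rnorm _](@ger0_norm R 2) //.
  rewrite -rnormZr e2 (le_trans (rnormD _ _)) // rnormN rnormZ normc_def /=.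
  rewrite expr0n expr1n add0r sqrtr1 mul1r.
  by have := herm u v u1 v1; have := herm u _ u1 iv; lra.
have [x0|x0] := eqVneq (rnorm x) 0.
  by rewrite -hinner_star rnorm_cstar (rnorm_eq0 x0) hinner0r !rnorm0 mul0r mulr0.
have [y0|y0] := eqVneq (rnorm y) 0.
  by rewrite (rnorm_eq0 y0) hinner0r !rnorm0 !mulr0.
have nrm (u : E) : rnorm u != 0 -> rnorm ((rnorm u)^-1%:C *: u) = 1.
  by move=> u0; rewrite rnormZr ger0_norm ?invr_ge0 ?rnorm_ge0 // mulVf.
have := unit _ _ (nrm x x0) (nrm y y0).
rewrite hinnerZr hinnerZl conjc_real !rnormZr !ger0_norm ?invr_ge0 ?rnorm_ge0 //.
rewrite mulrA -invfM mulrC ler_pdivrMr; last first.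
  by rewrite mulr_gt0 // lt_def rnorm_ge0 ?x0 ?y0.
by rewrite [rnorm y * _]mulrC.
Qed.

(** The multiplier m^* acting on the right of the first variable of the inner
    product comes out as m on the left. *)
Lemma mact_hinner x y z (m : multiplier A) :
  is_mact x (mult_adj m) y -> <{y | z}> = lmult m <{x | z}>.
Proof.
move=> xy; apply: cmul_inj => a; rewrite -[a]cstarK -hinner_actl xy.
by rewrite hinner_actl cstar_lmult_adj multP.
Qed.

End HilbertModule.

Section TwistedModule.
Variables (R : realType) (G : lchGroupType) (A : cstarAlgType R).
Variables (S : twisted_system G A) (E : twisted_module S).

Lemma rnorm_gamma r (x : E) : rnorm (gamma E r x) = rnorm x.
Proof. by rewrite /rnorm gamma_isometry. Qed.

Lemma gammaB r (x y : E) : gamma E r (x - y) = gamma E r x - gamma E r y.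
Proof.
by rewrite addrC -scaleN1r gamma_linear scaleN1r addrC.
Qed.

(** The values of the coefficient function of gamma_r y are the values that the
    twisted action Gamma_r prescribes; this identity is the source of all
    equivariance. *)
Lemma bra_gamma (z y : E) r s :
  bra z (gamma E r y) (r * s)%g =
  lmult (mult_adj (omega S r s)) (alpha S r (bra z y s)).
Proof.
rewrite /bra -gamma_inner (mact_hinner _ (gammaM r s z)).
by rewrite unitary_lmultK //; exact: omega_unitary.
Qed.

(** gamma_r (gamma_(r^-1) v) agrees with v up to the unitary multiplier
    omega(r, r^-1)^*, which on vectors v.b can be absorbed into b. *)
Lemma gamma_range r (v : E) (b : A) : exists u, gamma E r u = v <.> b.
Proof.
have := gammaM r r^-1%g v (lmult (omega S r r^-1%g) b).
rewrite mulgV gamma1g unitary_lmultK; last exact: omega_unitary.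
move=> <-.
exists (gamma E r^-1%g v <.> aut_inv (alpha S r) (lmult (omega S r r^-1%g) b)).
by rewrite gamma_act aut_invK.
Qed.

(** Pairing with all v.b recovers b^* <v|w>, which determines w. *)
Lemma gamma_sep r (w w' : E) :
  (forall u, <{gamma E r u | w}> = <{gamma E r u | w'}>) -> w = w'.
Proof.
move=> H; apply: hinner_inj => v; apply: cmul_inj => a; rewrite -[a]cstarK.
by rewrite -!hinner_actl; have [u <-] := gamma_range r v a^#.
Qed.

End TwistedModule.

(** * Integrals of vector-valued step functions *)

Section SimpleFunctions.
Variables (R : realType) (d : measure_display) (T : measurableType d).
Variables (mu : {measure set T -> \bar R}) (V : normedModType R[i]).
Implicit Types (s : seq (set T * V)) (D B : set T) (f g : T -> V) (c : V).

(** A step function is presented by a list of pairs (set, value), the sets being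
    allowed to overlap, so that sums of step functions are concatenations. *)
Definition step_fun s (x : T) : V := \sum_(p <- s) (\1_(p.1) x : R)%:C *: p.2.

Definition step_int D s : V := \sum_(p <- s) (fine (mu (D `&` p.1)))%:C *: p.2.

Definition finite_pieces s : Prop :=
  forall p, p \in [seq p.1 | p <- s] -> measurable p /\ (mu p < +oo)%E.

(** This form of measurability makes sense for nonseparable values and is stable
    under subtraction of step functions. *)
Definition dist_measurable f : Prop :=
  forall c, measurable_fun setT (fun x => rnorm (f x - c)).

Lemma finite_pieces_cons p s :
  finite_pieces (p :: s) <->
  (measurable p.1 /\ (mu p.1 < +oo)%E) /\ finite_pieces s.
Proof.
split=> [H|[H1 H2] B]; last by rewrite inE => /orP[/eqP->//|/H2].
split; first by apply: H; rewrite inE eqxx.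
by move=> B Bs; apply: H; rewrite inE Bs orbT.
Qed.

Lemma finite_pieces_cat s t :
  finite_pieces s -> finite_pieces t -> finite_pieces (s ++ t).
Proof. by move=> Hs Ht p; rewrite map_cat mem_cat => /orP[/Hs|/Ht]. Qed.

Lemma step_fun_cat s t x : step_fun (s ++ t) x = step_fun s x + step_fun t x.
Proof. by rewrite /step_fun big_cat. Qed.

Lemma step_int_cat D s t : step_int D (s ++ t) = step_int D s + step_int D t.
Proof. by rewrite /step_int big_cat. Qed.

(** Subtracting one term 1_B c amounts to shifting the centre of the distance by
    c on B. *)
Lemma dist_measurable_sub f s :
  (forall p, p \in [seq p.1 | p <- s] -> measurable p) ->
  dist_measurable f -> dist_measurable (fun x => f x - step_fun s x).
Proof.
elim: s f => [|[B c] s IH] f ms mf.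
  by move=> c; under eq_fun do rewrite /step_fun big_nil subr0; exact: mf.
have mB : measurable B by apply: ms; rewrite inE eqxx.
have -> : (fun x => f x - step_fun ((B, c) :: s) x) =
    (fun x => f x - (\1_B x : R)%:C *: c - step_fun s x).
  by apply/funext => x; rewrite /step_fun big_cons opprD addrA.
apply: IH => [p ps|c']; first by apply: ms; rewrite inE ps orbT.
have -> : (fun x => rnorm (f x - (\1_B x : R)%:C *: c - c')) =
    (fun x => if x \in B then rnorm (f x - (c + c')) else rnorm (f x - c')).
  apply/funext => x; rewrite indicE.
  by case: (x \in B); rewrite ?scale1r ?scale0r ?subr0 // opprD addrA.
apply: measurable_fun_ifT; [|exact: mf|exact: mf].
apply: (measurable_fun_bool true); rewrite setTI.
rewrite (_ : _ @^-1` _ = B) //.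
by apply/seteqP; split=> x /=; [move/set_mem|move/mem_set].
Qed.

Lemma measurable_rnorm_dist f s : finite_pieces s -> dist_measurable f ->
  measurable_fun setT (fun x => rnorm (f x - step_fun s x)).
Proof.
move=> fs mf; have := dist_measurable_sub (fun p ps => (fs p ps).1) mf 0.
by under eq_fun do rewrite subr0.
Qed.

Lemma dist_measurable_cst c : dist_measurable (fun=> c).
Proof. by move=> c'; exact: measurable_cst. Qed.

Lemma measurable_rnorm_step_fun c s : finite_pieces s ->
  measurable_fun setT (fun x => rnorm (c + step_fun s x)).
Proof.
move=> fs; have := measurable_rnorm_dist fs (dist_measurable_cst (- c)).
by under eq_fun do rewrite -opprD rnormN.
Qed.

Lemma fine_muI D B C : measurable D -> (mu D < +oo)%E -> measurable B ->
  measurable C ->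
  fine (mu (D `&` C)) = fine (mu (D `&` B `&` C)) + fine (mu ((D `\` B) `&` C)).
Proof.
move=> mD Dfin mB mC.
have fin X : measurable X -> X `<=` D -> mu X \is a fin_num.
  move=> mX XD; rewrite ge0_fin_numE // (le_lt_trans _ Dfin) //.
  by apply: le_measure; rewrite ?inE.
have mI : measurable (D `&` B `&` C) by do 2 apply: measurableI => //.
have mS : measurable ((D `\` B) `&` C).
  by apply: measurableI => //; exact: measurableD.
rewrite -fineD; [|apply: fin => // x [[]]//..].
rewrite -measureU //.
  congr (fine (mu _)); apply/seteqP; split=> [x [Dx Cx]|x [[[]]|[[]]]//].
  by have [Bx|Bx] := pselect (B x); [left|right].
by apply/seteqP; split=> // x [[[_ Bx] _] [[_ nBx] _]].
Qed.

Lemma step_int_split D B s : measurable D -> (mu D < +oo)%E -> measurable B ->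
  finite_pieces s -> step_int D s = step_int (D `&` B) s + step_int (D `\` B) s.
Proof.
move=> mD Dfin mB; elim: s => [|p s IH] fs.
  by rewrite /step_int !big_nil addr0.
have [[mp _] {}/IH IH] := (finite_pieces_cons p s).1 fs.
move: IH; rewrite /step_int !big_cons => ->.
by rewrite (fine_muI mD Dfin mB mp) rmorphD scalerDl addrACA.
Qed.

(** Induction on the presentation: the first set B splits D into D & B and D \ B,
    on which the first term is the constant b, respectively 0, and can be absorbed
    into c.  Making D and c vary is what makes the induction go through
    without a disjoint presentation of the step function. *)
Lemma le_integral_on D c s :
  measurable D -> (mu D < +oo)%E -> finite_pieces s ->
  ((rnorm ((fine (mu D))%:C *: c + step_int D s))%:E
    <= \int[mu]_(x in D) (rnorm (c + step_fun s x))%:E)%E.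
Proof.
elim: s D c => [|[B b] s IH] D c mD Dfin fs.
  rewrite /step_int big_nil addr0 rnormZr ger0_norm ?fine_ge0 //.
  under eq_integral do rewrite /step_fun big_nil addr0.
  by rewrite integral_cst // EFinM muleC fineK // ge0_fin_numE.
have [[/= mB _] fs'] := (finite_pieces_cons _ _).1 fs.
have mI : measurable (D `&` B) by exact: measurableI.
have mS : measurable (D `\` B) by exact: measurableD.
have fin X : measurable X -> X `<=` D -> (mu X < +oo)%E.
  by move=> mX XD; rewrite (le_lt_trans _ Dfin) //; apply: le_measure; rewrite ?inE.
have finI := fin _ mI (@subIsetl _ _ _).
have finS := fin _ mS (@subDsetl _ _ _).
rewrite -[X in integral _ X _](setUIDK D B) ge0_integral_setU //=; first last.
- by apply/disj_setPS => x [[_ Bx] [_ nBx]].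
- by move=> x _; rewrite lee_fin rnorm_ge0.
- apply/measurable_EFinP; apply: measurable_funTS.
  exact: measurable_rnorm_step_fun.
rewrite (@eq_integral _ _ _ mu (D `&` B)
    (fun x => (rnorm (c + b + step_fun s x))%:E));
  last first.
  move=> x; rewrite inE => -[_ Bx]; rewrite /step_fun big_cons /= indicE mem_set //.
  by rewrite scale1r addrA.
rewrite (@eq_integral _ _ _ mu (D `\` B)
    (fun x => (rnorm (c + step_fun s x))%:E));
  last first.
  move=> x; rewrite inE => -[_ Bx]; rewrite /step_fun big_cons /= indicE memNset //.
  by rewrite scale0r add0r.
apply: le_trans (leeD (IH _ _ mI finI fs') (IH _ _ mS finS fs')).
rewrite -EFinD lee_fin; apply: le_trans (rnormD _ _).
rewrite [step_int D (_ :: _)]big_cons -/(step_int D s).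
rewrite (step_int_split mD Dfin mB fs') /=.
have := fine_muI mD Dfin mB measurableT; rewrite !setIT => ->.
by rewrite rmorphD scalerDl scalerDr (AC (2*(1*2)) (1*3*4*(2*5))).
Qed.

End SimpleFunctions.

Section Approximation.
Variables (R : realType) (d : measure_display) (T : measurableType d).
Variables (mu : {measure set T -> \bar R}) (V : normedModType R[i]).
Implicit Types (s : seq (set T * V)) (D B K : set T) (f g : T -> V) (c : V).

Lemma finite_carrier s : finite_pieces mu s ->
  exists D, [/\ measurable D, (mu D < +oo)%E &
    forall p, p \in [seq p.1 | p <- s] -> p `<=` D].
Proof.
elim: s => [_|[B b] s IH] /=; first by exists set0; rewrite measure0.
move=> /finite_pieces_cons[[/= mB Bfin] /IH[D [mD Dfin DP]]].
exists (B `|` D); split=> [||C]; first exact: measurableU.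
  apply: (@le_lt_trans _ _ (mu B + mu D)%E); first exact: measureU2.
  exact: lte_add_pinfty.
rewrite inE => /orP[/eqP->|/DP CD]; first exact: subsetUl.
exact: subset_trans (@subsetUr _ _ _).
Qed.

Lemma rnorm_step_int_le s : finite_pieces mu s ->
  ((rnorm (step_int mu setT s))%:E <= \int[mu]_x (rnorm (step_fun s x))%:E)%E.
Proof.
move=> fs; have [D [mD Dfin DP]] := finite_carrier fs.
have := le_integral_on 0 mD Dfin fs; rewrite scaler0 add0r.
have -> : step_int mu D s = step_int mu setT s.
  apply: eq_big_seq => p ps; rewrite setTI; congr ((fine (mu _))%:C *: _).
  by apply/setIidPr/DP/map_f.
under eq_integral do rewrite add0r.
move/le_trans; apply; apply: ge0_subset_integral => //.
- apply/measurable_EFinP.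
  by have := measurable_rnorm_step_fun 0 fs; under eq_fun do rewrite add0r.
- by move=> x _; rewrite lee_fin rnorm_ge0.
Qed.

Definition step_approx f s (e : R) : Prop :=
  finite_pieces mu s /\ (\int[mu]_x (rnorm (f x - step_fun s x))%:E <= e%:E)%E.

Lemma step_fun_opp s x : step_fun [seq (p.1, - p.2) | p <- s] x = - step_fun s x.
Proof.
rewrite /step_fun big_map -sumrN; apply: eq_bigr => p _.
by rewrite /= scalerN.
Qed.

Lemma step_int_opp D s :
  step_int mu D [seq (p.1, - p.2) | p <- s] = - step_int mu D s.
Proof.
rewrite /step_int big_map -sumrN; apply: eq_bigr => p _.
by rewrite /= scalerN.
Qed.

(** The two step functions are compared through f and g.  The case f = g gives
    uniqueness of the integral and the Cauchy property of the integrals of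
    approximating step functions; the general case gives continuity of the
    integral for uniform convergence on K. *)
Lemma step_approx_dist f g s t K (a b e : R) :
  dist_measurable f -> dist_measurable g -> measurable K -> (mu K < +oo)%E ->
  (forall x, rnorm (f x - g x) <= e * \1_K x) -> 0 <= e ->
  step_approx f s a -> step_approx g t b ->
  rnorm (step_int mu setT s - step_int mu setT t) <= a + b + e * fine (mu K).
Proof.
move=> mf mg mK Kfin fgK e0 [fs sa] [ft tb].
have ft' : finite_pieces mu [seq (p.1, - p.2) | p <- t].
  by move=> B; rewrite -map_comp => /ft.
have fst := finite_pieces_cat fs ft'.
rewrite -lee_fin -step_int_opp -step_int_cat.
apply: le_trans (rnorm_step_int_le fst) _.
have mfs := measurable_rnorm_dist fs mf.
have mgt := measurable_rnorm_dist ft mg.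
have mind : measurable_fun setT (fun x => e * \1_K x : R).
  by apply: measurable_funM; [exact: measurable_cst|exact: measurable_indic].
apply: (@le_trans _ _ (\int[mu]_x ((rnorm (f x - step_fun s x))%:E +
    (rnorm (g x - step_fun t x))%:E + (e * \1_K x)%:E))%E).
  apply: ge0_le_integral => //.
  - by move=> x _; rewrite lee_fin rnorm_ge0.
  - apply/measurable_EFinP.
    by have := measurable_rnorm_step_fun 0 fst; under eq_fun do rewrite add0r.
  - apply/measurable_EFinP; apply: measurable_funD => //.
    exact: measurable_funD.
  move=> x _; rewrite lee_fin step_fun_cat step_fun_opp.
  have -> : step_fun s x - step_fun t x =
      (g x - step_fun t x) - (f x - step_fun s x) + (f x - g x).
    by rewrite opprB -addrA subrKA addrC subrKA.
  apply: le_trans (rnormD _ _) _; apply: lerD (fgK x).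
  by apply: le_trans (rnormD _ _) _; rewrite rnormN addrC.
rewrite ge0_integralD //; first last.
- by apply/measurable_EFinP.
- by move=> x _; rewrite lee_fin mulr_ge0.
- by apply/measurable_EFinP; apply: measurable_funD.
- by move=> x _; rewrite lee_fin addr_ge0 ?rnorm_ge0.
rewrite ge0_integralD //; first last.
- by apply/measurable_EFinP.
- by move=> x _; rewrite lee_fin rnorm_ge0.
- by apply/measurable_EFinP.
- by move=> x _; rewrite lee_fin rnorm_ge0.
rewrite !EFinD; apply: leeD; first exact: leeD.
under eq_integral do rewrite EFinM.
rewrite ge0_integralZl //; last exact/measurable_EFinP/measurable_indic.
by rewrite integral_indic // setIT EFinM fineK // ge0_fin_numE.
Qed.

(** If f(K) is covered by finitely many balls of radius e, then f is within e of
    a step function: assign to each point the centre of the first ball that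
    contains its image. *)
Lemma step_approx_exists f K (e : R) : dist_measurable f -> measurable K ->
  (mu K < +oo)%E -> 0 <= e -> (forall x, ~ K x -> f x = 0) ->
  (exists cs : seq V, forall x, K x -> exists2 c, c \in cs & rnorm (f x - c) <= e) ->
  exists s, step_approx f s (e * fine (mu K)).
Proof.
move=> mf mK Kfin e0 fK [cs csP].
suff [s [fs sP]] : exists s, finite_pieces mu s /\
    forall x, rnorm (f x - step_fun s x) <= e * \1_K x.
  exists s; split=> //.
  apply: (@le_trans _ _ (\int[mu]_x (e%:E * (\1_K x)%:E))%E).
    apply: ge0_le_integral => //.
    - by move=> x _; rewrite lee_fin rnorm_ge0.
    - by apply/measurable_EFinP; exact: measurable_rnorm_dist fs mf.
    - by apply: measurable_funeM; exact/measurable_EFinP/measurable_indic.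
    - by move=> x _; rewrite -EFinM lee_fin.
  rewrite ge0_integralZl //; last exact/measurable_EFinP/measurable_indic.
  by rewrite integral_indic // setIT EFinM fineK // ge0_fin_numE.
suff H D : measurable D -> D `<=` K ->
    (forall x, D x -> exists2 c, c \in cs & rnorm (f x - c) <= e) ->
    exists s, finite_pieces mu s /\
    forall x, (D x -> rnorm (f x - step_fun s x) <= e) /\
      (~ D x -> step_fun s x = 0).
  have [s [fs sP]] := H K mK (@subset_refl _ _) csP.
  exists s; split=> // x; have [s1 s2] := sP x; rewrite indicE.
  have [Kx|nKx] := pselect (K x); first by rewrite mem_set // mulr1; exact: s1.
  by rewrite memNset // mulr0 fK // s2 // subrr rnorm0.
elim: cs D {csP} => [|c cs IH] D mD DK DP.
  exists [::]; split=> // x; split=> [/DP[]//|_].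
  by rewrite /step_fun big_nil.
pose B := [set x | rnorm (f x - c) <= e].
have mB : measurable B.
  have := mf c measurableT `]-oo, e]%classic (measurable_itv _).
  rewrite setTI (_ : _ @^-1` _ = B) //.
have [||x [Dx nBx]|s [fs sP]] := IH (D `\` B); first exact: measurableD.
- by move=> x [/DK].
- have [c' + c'e] := DP x Dx; rewrite inE => /orP[/eqP c'c|c'cs]; last by exists c'.
  by exfalso; apply: nBx; rewrite /B /= -c'c.
exists ((D `&` B, c) :: s); split.
  apply/finite_pieces_cons; split=> //=; split; first exact: measurableI.
  rewrite (le_lt_trans _ Kfin) //; apply: le_measure; rewrite ?inE //.
    exact: measurableI.
  by move=> x [/DK].
move=> x; have [s1 s2] := sP x.
rewrite /step_fun big_cons -/(step_fun s x) /= indicE.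
split=> [Dx|nDx]; last first.
  by rewrite memNset => [|[]//]; rewrite scale0r add0r s2 // => -[].
have [Bx|nBx] := pselect (B x).
  by rewrite mem_set // scale1r s2 ?addr0 // => -[].
by rewrite memNset => [|[]//]; rewrite scale0r add0r; exact: s1.
Qed.

End Approximation.

(** * The Bochner integral of compactly supported functions *)

Section CompactSupport.
Variables (G : lchGroupType) (V : PreTopologicalZmodule.type).
Implicit Types f : G -> V.

(** The support is closed in K; compactness of K transfers to it because compact
    sets are closed in a Hausdorff space. *)
Lemma Cc_supp f K : continuous f -> compact K -> (forall x, ~ K x -> f x = 0) ->
  Cc f.
Proof.
move=> cf cK fK; split=> //; apply: (subclosed_compact _ cK).
  exact: closed_closure.
have cl : closed K by apply: compact_closed => //; exact: lchg_hausdorff.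
rewrite [X in _ `<=` X](closure_id K).1 //; apply: closure_subset => x /= fx.
by apply: contrapT => /fK fx0; rewrite fx0 eqxx in fx.
Qed.

Lemma CcP f : Cc f -> continuous f /\
  exists2 K, compact K & forall x, ~ K x -> f x = 0.
Proof.
move=> [cf cK]; split=> //; exists (closure [set x | f x != 0]) => // x nx.
by apply: contrapT => /eqP fx; apply: nx; exact: subset_closure.
Qed.

End CompactSupport.

(** The equivalence of compactness with the finite subcover property is stated for
    pointed spaces; the group is pointed by its unit. *)
HB.instance Definition _ (G : lchGroupType) :=
  Topological.copy (pointed_group G) G.

Lemma compact_nbhs_cover (G : lchGroupType) (K : set G) (U : G -> set G) :
  compact K -> (forall x, K x -> nbhs x (U x)) ->
  exists s : seq G, forall x, K x -> exists2 y, y \in s & U y x.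
Proof.
move=> cK KU; have : compact (K : set (pointed_group G)) by [].
rewrite compact_cover => /(_ G K (fun x => (U x)°)) [||D _ DK].
- by move=> x _; exact: open_interior.
- by move=> x Kx; exists x => //; exact: KU.
by exists (finmap.enum_fset D) => x /DK[y yD /interior_subset Uyx]; exists y.
Qed.

Section BochnerIntegral.
Variables (R : realType) (G : lchGroupType).
Variables (mu : {measure set (borel_type G) -> \bar R}) (mu_haar : left_haar mu).

Lemma open_measurable_borel (U : set G) :
  open U -> measurable (U : set (borel_type G)).
Proof. by move=> oU; exact: sub_sigma_algebra. Qed.

Lemma compact_measurable_borel (K : set G) :
  compact K -> measurable (K : set (borel_type G)).
Proof.
move=> cK; rewrite -[K]setCK; apply: measurableC; apply: open_measurable_borel.
by rewrite openC; apply: compact_closed => //; exact: lchg_hausdorff.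
Qed.

Lemma continuous_dist_measurable (V : normedModType R[i]) (f : G -> V) :
  continuous f -> dist_measurable (f : borel_type G -> V).
Proof.
move=> cf c; apply: (measurability _ (RGenOInfty.measurableE R)).
move=> _ [_ [a ->] <-]; rewrite setTI; apply: open_measurable_borel.
rewrite openE => x /=; rewrite in_itv /= andbT => ax.
have /continuous_rnormP/(_ x _) H := cf.
have d0 : 0 < rnorm (f x - c) - a by rewrite subr_gt0.
apply: filterS (H _ d0) => y /= xy; rewrite in_itv /= andbT.
have := rnorm_dist (f x) (f y) c.
by move: xy; lra.
Qed.

Section Values.
Variable V : normedModType R[i].
Implicit Types (f g : G -> V) (v w : V).

(** Passage from families of sets and vectors indexed by an ordinal to lists.  The
    integrability of the distance function reduces to a bound on its integral,
    since that function is measurable for continuous f. *)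
Lemma is_bochnerP f v : continuous f -> is_bochner mu f v <->
  forall e, 0 < e -> exists s, step_approx mu f s e /\
    rnorm (v - step_int mu setT s) <= e.
Proof.
move=> cf; have mf := continuous_dist_measurable cf; split=> H e /H.
  move=> [n [B [c [Bfin _ De Ie]]]].
  exists [seq (B k, c k) | k <- enum 'I_n].
  have fin : finite_pieces mu [seq (B k, c k) | k <- enum 'I_n].
    by move=> _ /mapP[_ /mapP[k _ ->] ->]; exact: Bfin.
  split.
    split=> //; under eq_integral do rewrite /step_fun big_map big_enum.
    exact: De.
  rewrite /step_int big_map big_enum /=.
  by under eq_bigr do rewrite setTI.
move=> [s [[fs sa] sv]].
exists (size s), (fun k => (tnth (in_tuple s) k).1),
  (fun k => (tnth (in_tuple s) k).2).
have stepE x : step_fun s x = \sum_(k < size s)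
    (\1_((tnth (in_tuple s) k).1) x : R)%:C *: (tnth (in_tuple s) k).2.
  by rewrite /step_fun big_tnth.
have distE : (fun x : borel_type G => (rnorm (f x - \sum_(k < size s)
    (\1_((tnth (in_tuple s) k).1) x : R)%:C *: (tnth (in_tuple s) k).2))%:E) =
    (fun x => (rnorm (f x - step_fun s x))%:E).
  by apply/funext => x; rewrite stepE.
rewrite /= distE; split=> //.
- by move=> k; apply/fs/map_f/mem_tnth.
- apply/integrableP; split.
    by apply/measurable_EFinP; exact: measurable_rnorm_dist fs mf.
  under eq_integral do rewrite gee0_abs ?lee_fin ?rnorm_ge0 //.
  exact: le_lt_trans sa (ltry _).
- rewrite (_ : \sum_(k < _) _ = step_int mu setT s) //.
  by rewrite /step_int [RHS]big_tnth; apply: eq_bigr => k _; rewrite setTI.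
Qed.

Lemma is_bochner_dist f g v w K e : continuous f -> continuous g ->
  compact K -> (forall x, ~ K x -> f x = g x) ->
  (forall x, rnorm (f x - g x) <= e) ->
  is_bochner mu f v -> is_bochner mu g w ->
  rnorm (v - w) <= e * fine (mu K).
Proof.
move=> cf cg cK fgK fge /is_bochnerP-/(_ cf) fv /is_bochnerP-/(_ cg) gw.
have e0 : 0 <= e by exact: le_trans (rnorm_ge0 _) (fge 1%g).
apply/ler_addgt0Pr => h h0.
have h4 : 0 < h / 4 by rewrite divr_gt0.
have [s [fs vs]] := fv _ h4.
have [t [gt wt]] := gw _ h4.
have fgI x : rnorm (f x - g x) <= e * \1_K x.
  rewrite indicE; have [Kx|nKx] := pselect (K x); first by rewrite mem_set // mulr1.
  by rewrite memNset // mulr0 fgK // subrr rnorm0.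
have := step_approx_dist (continuous_dist_measurable cf)
  (continuous_dist_measurable cg) (compact_measurable_borel cK)
  (haar_compact mu_haar cK) fgI e0 fs gt.
have := rnorm_dist v (step_int mu setT s) w.
have := rnorm_dist (step_int mu setT s) (step_int mu setT t) w.
rewrite [rnorm (_ - w)]rnormB.
move: vs wt; rewrite [rnorm (w - _)]rnormB; lra.
Qed.

Lemma is_bochner_uniq f v w : continuous f ->
  is_bochner mu f v -> is_bochner mu f w -> v = w.
Proof.
move=> cf fv fw; apply/eqP; rewrite -subr_eq0; apply/eqP/rnorm_eq0/le_anti.
rewrite rnorm_ge0 andbT.
rewrite -(mul0r (fine (mu set0))).
apply: (is_bochner_dist cf cf compact0 _ _ fv fw) => // x.
by rewrite subrr rnorm0.
Qed.

Lemma bochnerE f v : continuous f -> is_bochner mu f v -> bochner mu f = v.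
Proof.
move=> cf fv; apply: (is_bochner_uniq cf _ fv).
exact: (xgetI (P := [set v | is_bochner mu f v]) 0 fv).
Qed.

End Values.

Lemma compact_totally_bounded (V : normedModType R[i]) (f : G -> V) K e :
  continuous f -> compact K -> 0 < e ->
  exists cs : seq V, forall x, K x -> exists2 c, c \in cs & rnorm (f x - c) <= e.
Proof.
move=> /continuous_rnormP cf cK e0.
have [s sP] := compact_nbhs_cover cK (fun x _ => cf x e e0).
exists [seq f x | x <- s] => x /sP[y ys xy].
by exists (f y); [exact: map_f|rewrite rnormB ltW].
Qed.

(** The integral exists: step functions within 1/(n+1) of f on K have integrals
    forming a Cauchy sequence, at speed 2 mu(K)/(n+1). *)
Lemma Cc_is_bochner (V : completeNormedModType R[i]) (f : G -> V) :
  Cc f -> is_bochner mu f (bochner mu f).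
Proof.
move=> /CcP[cf [K cK fK]]; have mf := continuous_dist_measurable cf.
have mK := compact_measurable_borel cK; have Kfin := haar_compact mu_haar cK.
suff [v fv] : exists v, is_bochner mu f v by rewrite (bochnerE cf fv).
have muK0 : 0 <= fine (mu K) by rewrite fine_ge0.
have ap n : exists s, step_approx mu f s (n.+1%:R^-1 * fine (mu K)).
  apply: step_approx_exists => //.
  by apply: (compact_totally_bounded cf cK); rewrite invr_gt0.
have [s sP] := choice ap.
pose a n : R := 2 * (n.+1%:R^-1 * fine (mu K)).
have aP e : 0 < e -> exists n, a n < e.
  move=> e0; exists (Num.truncn (2 * fine (mu K) / e)).
  rewrite /a mulrCA ltr_pdivrMl ?ltr0n // -ltr_pdivrMr //.
  exact: truncnS_gt.
have [n m nm||v vP] := @complete_seq _ V (fun n => step_int mu setT (s n)) a.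
- have H := step_approx_dist (e := 0) mf mf mK Kfin _ (lexx _) (sP m) (sP n).
  apply: (le_trans (H _)) => [x|]; first by rewrite mul0r subrr rnorm0.
  rewrite mul0r addr0 /a mulrDl !mul1r lerD2r ler_wpM2r //.
  by rewrite lef_pV2 ?posrE ?ltr0n // ler_nat.
- exact: aP.
exists v; apply/is_bochnerP => // e /aP[n an]; exists (s n).
have sn := sP n; split; last exact: le_trans (vP n) (ltW an).
split; first by case: sn.
apply: (le_trans sn.2); rewrite lee_fin; apply: le_trans (ltW an).
by rewrite /a ler_peMl ?ler1n // mulr_ge0 // invr_ge0.
Qed.

(** T maps step functions approximating f to step functions approximating T o f,
    the error growing at most by the norm of T. *)
Lemma bochner_linear (V W : completeNormedModType R[i]) (f : G -> V)
    (T : V -> W) (C : R) : linear T -> (forall v, rnorm (T v) <= C * rnorm v) ->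
  Cc f -> Cc (T \o f) /\ T (bochner mu f) = bochner mu (T \o f).
Proof.
move=> lT TC Ccf; have [cf [K cK fK]] := CcP Ccf.
have T0 : T 0 = 0 by have := lT (-1) 0 0; rewrite scaler0 addr0 scaleN1r addNr.
have TD v w : T (v + w) = T v + T w by have := lT 1 v w; rewrite !scale1r.
have TZ k v : T (k *: v) = k *: T v by have := lT k v 0; rewrite T0 !addr0.
have TN v : T (- v) = - T v by rewrite -scaleN1r TZ scaleN1r.
have C0 : 0 < `|C| + 1 by rewrite ltr_wpDl.
have TC' v : rnorm (T v) <= (`|C| + 1) * rnorm v.
  rewrite (le_trans (TC v)) // ler_wpM2r ?rnorm_ge0 //.
  by rewrite (le_trans (ler_norm C)) // lerDl.
have cTf : continuous (T \o f).
  apply/continuous_rnormP => x e e0; have /continuous_rnormP H := cf.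
  have e0' : 0 < e / (`|C| + 1) by rewrite divr_gt0.
  apply: filterS (H x _ e0') => y xy /=; rewrite -TN -TD.
  by rewrite (le_lt_trans (TC' _)) // mulrC -ltr_pdivlMr.
split; first by apply: (Cc_supp cTf cK) => x /fK /= ->.
apply/esym/bochnerE => //; apply/is_bochnerP => // e e0.
have /is_bochnerP-/(_ cf) fv := Cc_is_bochner Ccf.
have [|s [[fs sa] sv]] := fv (e / (`|C| + 1)); first by rewrite divr_gt0.
exists [seq (p.1, T p.2) | p <- s].
have TS I (r : seq I) (F : I -> V) : T (\sum_(i <- r) F i) = \sum_(i <- r) T (F i).
  by elim: r => [|i r IH]; rewrite ?big_nil // !big_cons TD IH.
have stepT x : step_fun [seq (p.1, T p.2) | p <- s] x = T (step_fun s x).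
  by rewrite /step_fun big_map TS; apply: eq_bigr => p _; rewrite TZ.
have fs' : finite_pieces mu [seq (p.1, T p.2) | p <- s].
  by move=> B; rewrite -map_comp => /fs.
have mTf := continuous_dist_measurable cTf.
have mf := continuous_dist_measurable cf.
split.
  split=> //.
  apply: (@le_trans _ _
    (\int[mu]_x ((`|C| + 1)%:E * (rnorm (f x - step_fun s x))%:E))%E).
    apply: ge0_le_integral => //.
    - by move=> x _; rewrite lee_fin rnorm_ge0.
    - by apply/measurable_EFinP; exact: measurable_rnorm_dist fs' mTf.
    - apply: measurable_funeM; apply/measurable_EFinP.
      exact: measurable_rnorm_dist fs mf.
    - by move=> x _; rewrite -EFinM lee_fin stepT /= -TN -TD TC'.
  rewrite ge0_integralZl //; last 2 first.
  - by apply/measurable_EFinP; exact: measurable_rnorm_dist fs mf.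
  - by move=> x _; rewrite lee_fin rnorm_ge0.
  apply: (@le_trans _ _ ((`|C| + 1)%:E * (e / (`|C| + 1))%:E)%E).
    by apply: lee_wpmul2l => //; rewrite lee_fin ltW.
  by rewrite -EFinM lee_fin mulrC divfK // gt_eqF.
have -> : step_int mu setT [seq (p.1, T p.2) | p <- s] = T (step_int mu setT s).
  by rewrite /step_int big_map TS; apply: eq_bigr => p _; rewrite TZ.
rewrite -TN -TD (le_trans (TC' _)) // mulrC -ler_pdivlMr //.
Qed.

End BochnerIntegral.

(** * Nets of cutoff functions *)

Section CutoffNets.
Variables (R : realType) (G : lchGroupType).

(** A locally compact Hausdorff space is completely regular: separate x from the
    complement of the interior of a compact neighbourhood K of x. *)
Lemma bump_at (x : G) : exists h : G -> R,
  [/\ continuous h, forall y, 0 <= h y, h x = 1 &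
    exists2 K, compact K & forall y, ~ K y -> h y = 0].
Proof.
have [K] := @lchg_locally_compact G x I.
rewrite /within /= => Kx [cK _]; have {}Kx : nbhs x K.
  by apply: filterS Kx => y; exact.
have /(uniform_separatorP (R := R))[f [cf f01 f0 f1]] :=
  @locally_compact_completely_regular G R (@lchg_locally_compact G)
  (@lchg_hausdorff G) x (~` K°) (open_closedC (@open_interior _ K)) (fun H => H Kx).
exists (fun y => 1 - f y); split.
- by move=> y; apply: cvgB; [exact: cvg_cst|exact: cf].
- move=> y; have := f01 (f y) (imageP f I).
  by rewrite /= in_itv /= subr_ge0 => /andP[].
- by rewrite (f0 (f x)) ?subr0 //; exists x.
exists K => // y nKy; rewrite (f1 (f y)) ?subrr //; exists y => // /interior_subset.
exact.
Qed.

(** Cover K by finitely many sets on which a bump exceeds 1/2; the sum g of these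
    bumps exceeds 1/2 on K, so min(1, 2 g) is the required function. *)
Lemma urysohn_Cc (K : set G) : compact K -> exists phi : G -> R,
  [/\ Cc phi, forall x, 0 <= phi x <= 1 & forall x, K x -> phi x = 1].
Proof.
move=> cK; have [h hP] := choice bump_at.
have [s sP] : exists s : seq G, forall x, K x -> exists2 y, y \in s & 1 / 2 < h y x.
  apply: (compact_nbhs_cover cK) => x _; have [ch _ hx _] := hP x.
  apply: (ch x [set t | 1 / 2 < t]); rewrite hx.
  apply: open_nbhs_nbhs; split; first exact: open_gt.
  by rewrite /= ltr_pdivrMr // mul1r ltr1n.
have [g [cg g0 [C cC gC] hg]] : exists g : G -> R, [/\ continuous g,
    forall x, 0 <= g x, exists2 C, compact C & forall x, ~ C x -> g x = 0 &
    forall y x, y \in s -> h y x <= g x].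
  elim: s {sP} => [|y s [g [cg g0 [C cC gC] hg]]].
    exists (fun=> 0); split=> //; first by move=> x; exact: cvg_cst.
    by exists set0 => //; exact: compact0.
  have [ch h0 _ [D cD hD]] := hP y.
  exists (fun x => h y x + g x); split.
  - by move=> x; apply: cvgD; [exact: ch|exact: cg].
  - by move=> x; rewrite addr_ge0.
  - exists (D `|` C); first exact: compactU.
    by move=> x /not_orP[Dx Cx]; rewrite hD ?gC ?addr0.
  - move=> z x; rewrite inE => /orP[/eqP->|zs]; first by rewrite lerDl.
    by rewrite (le_trans (hg _ _ zs)) // lerDr.
exists (fun x => Num.min 1 (2 * g x)); split.
- apply: (Cc_supp _ cC) => [x|x /gC ->]; last by rewrite mulr0 min_r.
  apply: (@continuous_min R G (fun=> 1) (fun x => 2 * g x)); first exact: cvg_cst.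
  by apply: cvgM; [exact: cvg_cst|exact: cg].
- by move=> x; rewrite le_min ler01 mulr_ge0 //= ge_min lexx.
- move=> x /sP[y ys hyx]; apply/min_l.
  by have := hg y x ys; lra.
Qed.

(** The net is indexed by the compact subsets of G, ordered by inclusion, with an
    Urysohn function chosen for each. *)
Lemma cutoff_net_exists : inhabited (cutoff_net R G).
Proof.
have H (K : {K : set G | compact K}) := urysohn_Cc (proj2_sig K).
have [phi phiP] := choice H.
have i0 : {K : set G | compact K} by exists set0; exact: compact0.
constructor; apply: (@CutoffNet R G {K : set G | compact K}
  (fun K L => proj1_sig K `<=` proj1_sig L) (inhabits i0) _ _ _ phi).
- by move=> K; exact: subset_refl.
- by move=> K L M; exact: subset_trans.
- move=> K L.
  exists (exist _ _ (compactU (proj2_sig K) (proj2_sig L))).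
  by split=> /=; [exact: subsetUl|exact: subsetUr].
- by move=> K; have [] := phiP K.
- by move=> K; have [] := phiP K.
- move=> K cK e e0; exists (exist _ K cK) => L /= KL x Kx.
  by have [_ _ ->] := phiP L; [rewrite subrr normr0|exact: KL].
Qed.

Lemma mulg_continuousr (r : G) : continuous (fun x : G => (r * x)%g).
Proof.
move=> x; apply: (@continuous_comp _ _ _ (fun x : G => (r, x))
  (fun p : G * G => (p.1 * p.2)%g)); last exact: mulg_continuous.
by apply: cvg_pair; [exact: cvg_cst|exact: cvg_id].
Qed.

Lemma compact_translate (K : set G) (r : G) : compact K ->
  compact [set (r * x)%g | x in K].
Proof.
move=> cK; apply: continuous_compact cK; apply: continuous_subspaceT.
exact: mulg_continuousr.
Qed.

Lemma Cc_translate (V : PreTopologicalZmodule.type) (f : G -> V) (r : G) :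
  Cc f -> Cc (fun x => f (r * x)%g).
Proof.
move=> /CcP[cf [K cK fK]]; apply: (@Cc_supp _ _ _ [set (r^-1 * x)%g | x in K]).
- move=> x; apply: (@continuous_comp _ _ _ (fun x : G => (r * x)%g) f).
    exact: mulg_continuousr.
  exact: cf.
- exact: compact_translate.
move=> x nx; apply: fK => Krx; apply: nx; exists (r * x)%g => //.
by rewrite mulgA mulVg mul1g.
Qed.

Lemma net_translate_cvg1 (N : cutoff_net R G) (r : G) (K : set G) :
  compact K -> forall e : R, 0 < e ->
  exists i0, forall i, net_le i0 i ->
  forall x, K x -> `|N i (r * x)%g - 1| < e.
Proof.
move=> cK e e0; have [i0 iP] := net_cvg1 N (@compact_translate K r cK) e0.
by exists i0 => i i0i x Kx; apply: iP i0i _ _; exists x.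
Qed.

Definition net_translate (N : cutoff_net R G) (r : G) : cutoff_net R G :=
  CutoffNet (net_inhabited N) (@net_refl _ _ N) (@net_trans _ _ N)
    (@net_directed _ _ N) (fun i => @Cc_translate _ _ r (net_Cc i))
    (fun i x => net_01 i (r * x)%g) (@net_translate_cvg1 N r).

Lemma net_filter_proper (N : cutoff_net R G) : ProperFilter (net_filter N).
Proof.
apply: Build_ProperFilter_ex.
  by move=> P [i iP]; exists i; apply: iP; exact: net_refl.
split.
- by case: (net_inhabited N) => i; exists i.
- move=> P Q [i iP] [j jQ]; have [k [ik jk]] := net_directed i j.
  exists k => l kl; split; [apply: iP|apply: jQ]; exact: net_trans kl.
- by move=> P Q PQ [i iP]; exists i => j /iP/PQ.
Qed.

End CutoffNets.

(** * Bilinear maps and uniform boundedness *)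

Lemma bilinear_continuous (R : realType) (T : topologicalType)
    (V W U : normedModType R[i]) (b : V -> W -> U) (C : R)
    (f : T -> V) (g : T -> W) :
  (forall x x' y, b (x - x') y = b x y - b x' y) ->
  (forall x y y', b x (y - y') = b x y - b x y') ->
  (forall x y, rnorm (b x y) <= C * (rnorm x * rnorm y)) ->
  continuous f -> continuous g -> continuous (fun t => b (f t) (g t)).
Proof.
move=> bBl bBr bC /continuous_rnormP cf /continuous_rnormP cg.
apply/continuous_rnormP => t e e0.
pose M := rnorm (f t) + rnorm (g t) + 1.
have M0 : 0 < M by rewrite ltr_wpDl // addr_ge0 // rnorm_ge0.
have D0 : 0 < `|C| + 1 by rewrite ltr_wpDl.
pose h := Num.min 1 (e / (2 * (M * (`|C| + 1)))).
have h0 : 0 < h by rewrite lt_min ltr01 divr_gt0 // !mulr_gt0.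
have bD x y : rnorm (b x y) <= (`|C| + 1) * (rnorm x * rnorm y).
  rewrite (le_trans (bC x y)) // ler_wpM2r ?mulr_ge0 ?rnorm_ge0 //.
  by rewrite (le_trans (ler_norm C)) // lerDl.
near=> u.
have fu : rnorm (f t - f u) < h by near: u; exact: cf.
have gu : rnorm (g t - g u) < h by near: u; exact: cg.
have -> : b (f t) (g t) - b (f u) (g u) =
    b (f t - f u) (g t) + b (f u) (g t - g u).
  by rewrite bBl bBr addrA subrK.
apply: (le_lt_trans (rnormD _ _)).
have fuM : rnorm (f u) <= M.
  have := ler_rnormB (f u) (f t); rewrite rnormB.
  have h1 : h <= 1 by rewrite ge_min lexx.
  by have := rnorm_ge0 (g t); rewrite /M; move: fu; lra.
have gtM : rnorm (g t) <= M.
  by have := rnorm_ge0 (f t); rewrite /M; lra.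
have hE : h <= e / (2 * (M * (`|C| + 1))) by rewrite ge_min lexx orbT.
have eE : e = (`|C| + 1) * (e / (2 * (M * (`|C| + 1))) * M) +
              (`|C| + 1) * (e / (2 * (M * (`|C| + 1))) * M).
  by field; rewrite !gt_eqF.
rewrite eE; apply: ler_ltD.
  apply: (le_trans (bD _ _)); rewrite ler_pM2l //.
  by apply: ler_pM; rewrite ?rnorm_ge0 // (le_trans (ltW fu)).
apply: (le_lt_trans (bD _ _)); rewrite ltr_pM2l // mulrC.
apply: (@le_lt_trans _ _ (rnorm (g t - g u) * M)).
  by rewrite ler_wpM2l ?rnorm_ge0.
by rewrite ltr_pM2r // (lt_le_trans gu).
Unshelve. all: by end_near. Qed.

(** The uniform boundedness principle for the functionals <v|.>, by a gliding hump
    argument.  If B is unbounded, choose u_n in B with |u_n| > 2 n 13^(n+1) and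
    obtain x_(n+1) from x_n by adding plus or minus the positive multiple h_n of
    u_n of length 13^-(n+1); one of the two signs gives
    |<u_n|x_(n+1)>| >= 13^-(n+1) |u_n|.  The limit l is within 13^-(n+1)/12 of
    x_(n+1), so at least half of this value survives: |<u_n|l>| >= n. *)
Lemma weakly_bounded (R : realType) (A : cstarAlgType R) (E : hilbertModType A)
    (B : set E) :
  (forall y : E, exists M : R, forall v, B v -> rnorm <{v | y}> <= M) ->
  exists M : R, forall v, B v -> rnorm v <= M.
Proof.
move=> wB; apply: contrapT => nB.
(* With this ratio the tail r^(n+2) + r^(n+3) + ... is r^(n+1)/12, which the
   constant 6 of the inner product turns into half of r^(n+1). *)
pose r : R := 13^-1.
have r0 : 0 < r by rewrite invr_gt0.
have unb n : exists v, B v /\ 2 * n%:R * 13 ^+ n.+1 < rnorm v.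
  apply: contrapT => H; apply: nB; exists (2 * n%:R * 13 ^+ n.+1) => v Bv.
  by rewrite leNgt; apply/negP => vn; apply: H; exists v.
have [u uP] := choice unb.
have u0 n : 0 < rnorm (u n).
  by rewrite (le_lt_trans _ (uP n).2) // !mulr_ge0 // exprn_ge0.
pose h n : E := (r ^+ n.+1 / rnorm (u n))%:C *: u n.
have hn n : rnorm (h n) = r ^+ n.+1.
  rewrite rnormZr ger0_norm ?divfK ?gt_eqF //.
  by rewrite divr_ge0 ?rnorm_ge0 // exprn_ge0 // ltW.
have uh n : rnorm <{u n | h n}> = r ^+ n.+1 * rnorm (u n).
  rewrite hinnerZr rnormZr rnorm_hinnerxx ger0_norm; last first.
    by rewrite divr_ge0 ?rnorm_ge0 // exprn_ge0 // ltW.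
  by rewrite expr2 mulrA divfK ?gt_eqF.
pose step n (x : E) : E :=
  if r ^+ n.+1 * rnorm (u n) <= rnorm <{u n | x + h n}>
  then x + h n else x - h n.
pose fix x n : E := if n is n'.+1 then step n' (x n') else 0.
have xS n : rnorm (x n.+1 - x n) <= r ^+ n.+1.
  by rewrite /= /step; case: ifP => _; rewrite addrAC subrr add0r ?rnormN hn.
have ux n : r ^+ n.+1 * rnorm (u n) <= rnorm <{u n | x n.+1}>.
  rewrite /= /step; case: ifPn => //; rewrite -ltNge => lt.
  have : rnorm (<{u n | x n + h n}> - <{u n | x n - h n}>) =
      2 * (r ^+ n.+1 * rnorm (u n)).
    rewrite -hinnerBr opprB addrC addrA subrK -mulr2n -scaler_nat hinnerZr.
    by rewrite -(rmorph_nat (real_complex R)) rnormZr ger0_norm // uh.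
  have := rnormD <{u n | x n + h n}> (- <{u n | x n - h n}>); rewrite rnormN.
  by move: lt; lra.
have xx n m : (n <= m)%N -> rnorm (x m - x n) <= (r ^+ n - r ^+ m) / 12.
  elim: m => [|m IH].
    by rewrite leqn0 => /eqP->; rewrite !subrr rnorm0 mul0r.
  rewrite leq_eqVlt => /orP[/eqP->|/IH nm]; first by rewrite !subrr rnorm0 mul0r.
  have := rnorm_dist (x m.+1) (x m) (x n); have := xS m.
  have : r ^+ m = 13 * r ^+ m.+1 by rewrite exprS mulrA divff ?mul1r.
  move: nm; set a := r ^+ m.+1; set b := r ^+ m; set c := r ^+ n.
  by lra.
have [||l lP] := @complete_seq R E x (fun n => r ^+ n / 12).
- move=> n m /xx/le_trans; apply; rewrite ler_pM2r ?invr_gt0 //.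
  by rewrite gerBl exprn_ge0 // ltW.
- move=> e e0; have r1 : `|r| < 1 by rewrite gtr0_norm // invf_lt1 // ltr1n.
  have /cvgrPdist_lt/(_ e e0)[n _ /(_ n (leqnn n)) /=] := cvg_expr r1.
  rewrite sub0r normrN ger0_norm ?exprn_ge0 ?ltW // => rn.
  exists n; rewrite ltr_pdivrMr // (lt_le_trans rn) //.
  by rewrite ler_pMr // ler1n.
have [M MP] := wB l.
have [n Mn] : exists n : nat, M < n%:R.
  by exists (Num.truncn M).+1; exact: truncnS_gt.
have := MP _ (uP n).1; apply/negP; rewrite -ltNge.
apply: (lt_le_trans Mn).
have := ler_rnormB <{u n | x n.+1}> (<{u n | x n.+1}> - <{u n | l}>).
rewrite subKr -hinnerBr => A1.
have := rnorm_hinner (u n) (x n.+1 - l); rewrite [rnorm (_ - l)]rnormB => A2.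
have A3 : 6 * (rnorm (u n) * rnorm (l - x n.+1)) <=
    6 * (rnorm (u n) * (r ^+ n.+1 / 12)).
  by rewrite ler_pM2l // ler_wpM2l ?rnorm_ge0.
have A4 : n%:R <= 2^-1 * (r ^+ n.+1 * rnorm (u n)).
  rewrite mulrCA exprVn ler_pdivlMl ?exprn_gt0 // ler_pdivlMl //.
  by rewrite (le_trans _ (ltW (uP n).2)) // -mulrA [n%:R * _]mulrC.
move: (ux n) A1 A2 A3 A4; set a := r ^+ n.+1; set p := rnorm (u n).
by lra.
Qed.

(** * The operators attached to a square-integrable vector *)

Section SquareIntegrableVector.
Variables (R : realType) (G : lchGroupType).
Variables (mu : {measure set (borel_type G) -> \bar R}) (mu_haar : left_haar mu).
Variables (A : cstarAlgType R) (S : twisted_system G A).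
Variables (L : L2_module mu S) (E : twisted_module S) (z : E).
Implicit Types (y v : E) (l : L) (f : G -> A) (N : cutoff_net R G).

Lemma bra_continuous y : continuous (bra z y).
Proof.
apply: (@bilinear_continuous R G E E A (fun u v => <{u | v}>) 6).
- by move=> *; exact: hinnerBl.
- by move=> *; exact: hinnerBr.
- by move=> *; exact: rnorm_hinner.
- exact: gamma_continuous.
- by move=> x; exact: cvg_cst.
Qed.

Lemma cut_bra_Cc y N i : Cc (fun x => (N i x)%:C *: bra z y x).
Proof.
have /CcP[cN [K cK NK]] := net_Cc i.
apply: (Cc_supp _ cK) => [|x /NK ->]; last by rewrite rmorph0 scale0r.
apply: (@continuous_realZ R A G (N i) (bra z y)) => //.
exact: bra_continuous.
Qed.

Lemma ket_Cc f : Cc f -> Cc (fun x => gamma E x z <.> f x).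
Proof.
move=> /CcP[cf [K cK fK]].
have act0 v : v <.> (0 : A) = 0 by rewrite -(scale0r (0 : A)) hactZr scale0r.
have cg : continuous (fun x => gamma E x z <.> f x).
  apply: (@bilinear_continuous R G E A E (fun u a => u <.> a) 1).
  - by move=> u v a; rewrite hactDl -scaleN1r hactZl scaleN1r.
  - by move=> u a b; rewrite hactDr -scaleN1r hactZr scaleN1r.
  - by move=> u a; rewrite mul1r rnorm_hact.
  - exact: gamma_continuous.
  - exact: cf.
by apply: (Cc_supp cg cK) => x /fK ->; exact: act0.
Qed.

Lemma hinner_bochner (F : hilbertModType A) (w : F) (g : G -> F) : Cc g ->
  Cc (fun x => <{w | g x}>) /\
  <{w | bochner mu g}> = bochner mu (fun x => <{w | g x}>).
Proof.
apply: (@bochner_linear R G mu mu_haar F A g (fun x => <{w | x}>) (6 * rnorm w)).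
  by move=> k u v; rewrite hinnerDr hinnerZr.
by move=> v; rewrite -mulrA; exact: rnorm_hinner.
Qed.

Lemma hinner_ket y f : Cc f ->
  Cc (fun x => (bra z y x)^# ** f x) /\
  <{y | ket mu z f}> = bochner mu (fun x => (bra z y x)^# ** f x).
Proof.
have -> : (fun x => (bra z y x)^# ** f x) =
    (fun x => <{y | gamma E x z <.> f x}>).
  by apply/funext => x; rewrite hinner_act /bra hinner_star.
by move=> Cf; exact: hinner_bochner (ket_Cc Cf).
Qed.

Lemma Cc_bounded f : Cc f -> exists M : R, forall x, rnorm (f x) <= M.
Proof.
move=> /CcP[cf [K cK fK]].
have [s sP] := compact_totally_bounded cf cK (@ltr01 R).
exists (\sum_(c <- s) rnorm c + 1) => x.
have s0 : 0 <= \sum_(c <- s) rnorm c by apply: sumr_ge0 => c _; exact: rnorm_ge0.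
have [/sP[c cs fc]|/fK ->] := pselect (K x); last by rewrite rnorm0 addr_ge0.
have cS : rnorm c <= \sum_(c <- s) rnorm c.
  by rewrite (big_rem c) //= lerDl; apply: sumr_ge0 => ? _; exact: rnorm_ge0.
by have := ler_rnormB (f x) c; move: fc cS; lra.
Qed.

(** Both inner products are integrals, of phi_i g and of g = bra(y)^* f.  The cutoffs
    phi_i tend to 1 uniformly on the compact support K of g, and g is bounded. *)
Lemma cut_bra_pairing y f N e : Cc f -> 0 < e ->
  \forall i \near net_filter N,
    rnorm (<{cut_bra L z y N i | L2_q L f}> - <{y | ket mu z f}>) <= e.
Proof.
move=> Cf e0; have [Cg ->] := hinner_ket y Cf.
set g := fun x => (bra z y x)^# ** f x in Cg *.
have [M gM] := Cc_bounded Cg.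
have [cg [K cK gK]] := CcP Cg.
have M0 : 0 <= M := le_trans (rnorm_ge0 _) (gM 1%g).
pose k := M * fine (mu K) + 1.
have muK : 0 <= fine (mu K) by rewrite fine_ge0.
have k0 : 0 < k by rewrite ltr_wpDl // mulr_ge0.
have d0 : 0 < e / k by rewrite divr_gt0.
have [i0 iP] := net_cvg1 N cK d0.
exists i0 => i i0i.
have hE : (fun x => ((N i x)%:C *: bra z y x)^# ** f x) =
    (fun x => (N i x)%:C *: g x).
  by apply/funext => x; rewrite cstarZ conjc_real cmulZl.
rewrite L2_q_inner ?hE //; last exact: cut_bra_Cc.
have ch : continuous (fun x => (N i x)%:C *: g x).
  have [cN _] := net_Cc i.
  exact: (@continuous_realZ R A G (N i) g).
have Ch : Cc (fun x => (N i x)%:C *: g x).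
  by apply: (Cc_supp ch cK) => x /gK ->; rewrite scaler0.
apply: (@le_trans _ _ (e / k * M * fine (mu K))).
  apply: (is_bochner_dist mu_haar ch cg cK).
  - by move=> x /gK ->; rewrite scaler0.
  - move=> x; rewrite -[X in _ - X]scale1r -scalerBl -(rmorph1 (real_complex R)).
    rewrite -rmorphB rnormZr; have [Kx|/gK ->] := pselect (K x); last first.
      by rewrite rnorm0 mulr0 mulr_ge0 // ltW.
    apply: ler_pM; rewrite ?rnorm_ge0 //.
    by apply: ltW; exact: iP.
  - exact: Cc_is_bochner.
  - exact: Cc_is_bochner.
have -> : e / k * M * fine (mu K) = e * (M * fine (mu K) / k) by ring.
by rewrite ler_piMr ?(ltW e0) // ler_pdivrMr // mul1r lerDl.
Qed.

Lemma L2_dense l e : 0 < e -> exists2 f, Cc f & rnorm (l - L2_q L f) < e.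
Proof.
move=> e0; have : closure [set L2_q L f | f in [set f : G -> A | Cc f]] l.
  by rewrite L2_q_dense.
move=> /(_ [set l' | rnorm (l - l') < e]) [].
  by apply/nbhs_rnormP; exists e.
by move=> _ [[f Cf <-] lf]; exists f.
Qed.

Lemma L2_sep l l' :
  (forall f, Cc f -> <{l | L2_q L f}> = <{l' | L2_q L f}>) -> l = l'.
Proof.
move=> ll; apply/eqP; rewrite -subr_eq0; apply/eqP; set w := l - l'.
have wf f : Cc f -> <{w | L2_q L f}> = 0.
  by move=> Cf; rewrite hinnerBl ll // subrr.
have [//|w0] := pselect (w = 0).
have nw : 0 < rnorm w.
  by rewrite lt_def rnorm_ge0 andbT; apply/eqP => /rnorm_eq0.
have [|f Cf lf] := @L2_dense w (rnorm w / 6); first by rewrite divr_gt0.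
have := rnorm_hinner w (w - L2_q L f).
rewrite hinnerBr wf // subr0 rnorm_hinnerxx expr2.
have : 6 * (rnorm w * rnorm (w - L2_q L f)) < rnorm w * rnorm w.
  by rewrite mulrCA ltr_pM2l // mulrC -ltr_pdivlMr.
by move=> + H; rewrite ltNge H.
Qed.

Hypothesis z_si : square_integrable L z.

Lemma cut_bra_lim y N l : cut_bra L z y N @ net_filter N --> l ->
  forall f, Cc f -> <{l | L2_q L f}> = <{y | ket mu z f}>.
Proof.
move=> /(cvg_rnormP (net_filter_proper N)) Nl f Cf.
apply/eqP; rewrite -subr_eq0; apply/eqP/rnorm_eq0/le_anti.
rewrite rnorm_ge0 andbT; apply/ler_addgt0Pr => e e0; rewrite add0r.
have PF := net_filter_proper N.
have k0 : 0 < 6 * rnorm (L2_q L f) + 1.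
  by rewrite ltr_wpDl // mulr_ge0 // rnorm_ge0.
have d0 : 0 < e / 2 / (6 * rnorm (L2_q L f) + 1) by rewrite !divr_gt0.
have e2 : 0 < e / 2 by rewrite divr_gt0.
have [i [li pi]] := filter_ex (filterI (Nl _ d0) (cut_bra_pairing y N Cf e2)).
rewrite (le_trans (rnorm_dist _ <{cut_bra L z y N i | L2_q L f}> _)) //.
rewrite [leRHS](splitr e) lerD // -hinnerBl (le_trans (rnorm_hinner _ _)) //.
move: li => /= li; rewrite mulrCA.
apply: (@le_trans _ _
  (e / 2 / (6 * rnorm (L2_q L f) + 1) * (6 * rnorm (L2_q L f)))).
  by rewrite ler_wpM2r ?mulr_ge0 ?rnorm_ge0 // ltW.
rewrite mulrAC ler_pdivrMr // ler_wpM2l ?(ltW e2) //.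
by rewrite lerDl.
Qed.

(** Any two nets give limits with the same inner products against the dense
    subspace q(C_c(G,A)), hence the same limit. *)
Lemma bra2P y N : cut_bra L z y N @ net_filter N --> bra2 L z y.
Proof.
have cvgN M :
    cut_bra L z y M @ net_filter M --> lim (cut_bra L z y M @ net_filter M).
  have PM := net_filter_proper M.
  exact: cauchy_cvg (z_si y M).
have H : [set l : L | forall M : cutoff_net R G,
      cut_bra L z y M @ net_filter M --> l]
    (lim (cut_bra L z y N @ net_filter N)).
  move=> M; rewrite (@L2_sep (lim (cut_bra L z y N @ net_filter N))
    (lim (cut_bra L z y M @ net_filter M))) // => f Cf.
  by rewrite (cut_bra_lim (cvgN N) Cf) (cut_bra_lim (cvgN M) Cf).
exact: (xgetI 0 H N).
Qed.

Lemma hinner_bra2 y f : Cc f -> <{bra2 L z y | L2_q L f}> = <{y | ket mu z f}>.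
Proof.
by have [N] := cutoff_net_exists R G; apply: (cut_bra_lim (@bra2P y N)).
Qed.

(** gamma_r y and the translated net x |-> phi_i(r^-1 x) have as truncated
    coefficient functions exactly the images under Gamma_r of those of y and
    phi_i; pass to the limit. *)
Lemma bra2_gamma r y : bra2 L z (gamma E r y) = gamma L r (bra2 L z y).
Proof.
have [N] := cutoff_net_exists R G.
pose M := net_translate N r^-1%g.
have cutE i : cut_bra L z (gamma E r y) M i = gamma L r (cut_bra L z y N i).
  rewrite /cut_bra L2_gamma; last exact: cut_bra_Cc.
  congr (L2_q L _); apply/funext => x.
  have alphaZ k a : alpha S r (k *: a) = k *: alpha S r a.
    have := aut_linear (alpha S r) k a 0; have := aut_linear (alpha S r) (-1) 0 0.
    by rewrite scaler0 addr0 scaleN1r addNr => ->; rewrite !addr0.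
  rewrite alphaZ lmultZ; congr (_ *: _).
  by rewrite -bra_gamma mulgA mulgV mul1g.
have := @bra2P (gamma E r y) M.
rewrite (_ : cut_bra L z (gamma E r y) M = gamma L r \o cut_bra L z y N); last first.
  by apply/funext => i; exact: cutE.
move/(cvg_rnormP (net_filter_proper N)) => H1.
have /(cvg_rnormP (net_filter_proper N)) H2 := @bra2P y N.
have PN := net_filter_proper N.
apply/eqP; rewrite -subr_eq0; apply/eqP/rnorm_eq0/le_anti.
rewrite rnorm_ge0 andbT; apply/ler_addgt0Pr => e e0; rewrite add0r.
have e2 : 0 < e / 2 by rewrite divr_gt0.
have [i [/= i1 i2]] := filter_ex (filterI (H1 _ e2) (H2 _ e2)).
rewrite (le_trans (rnorm_dist _ (gamma L r (cut_bra L z y N i)) _)) //.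
rewrite [leRHS](splitr e) lerD //; first exact: ltW.
by rewrite -gammaB rnorm_gamma rnormB ltW.
Qed.

(** The graph of the adjoint of bra2, before that adjoint is known to exist. *)
Definition adj_pair l v : Prop := forall y, <{y | v}> = <{bra2 L z y | l}>.

(** For y fixed, |<v|y>| = |<bra2 y|l>| is bounded uniformly in the adjoint
    pairs with |l| <= 1; conclude by uniform boundedness and homogeneity. *)
Lemma adj_pair_bounded : exists C : R, forall l v, adj_pair l v ->
  rnorm v <= C * rnorm l.
Proof.
have [|C CP] := @weakly_bounded R A E
    [set v | exists2 l, rnorm l <= 1 & adj_pair l v].
  move=> y; exists (6 * rnorm (bra2 L z y)) => v [l l1 lv].
  rewrite -hinner_star rnorm_cstar lv (le_trans (rnorm_hinner _ _)) //.
  by rewrite ler_pM2l // ler_piMr // rnorm_ge0.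
exists C => l v lv.
have [l0|l0] := eqVneq (rnorm l) 0.
  suff -> : v = 0 by rewrite l0 mulr0 rnorm0.
  by apply: hinner_sep => y; rewrite lv (rnorm_eq0 l0) hinner0r.
have l0' : 0 < rnorm l by rewrite lt_def l0 rnorm_ge0.
have := CP ((rnorm l)^-1%:C *: v).
rewrite rnormZr ger0_norm ?invr_ge0 ?rnorm_ge0 // ler_pdivrMl // mulrC; apply.
exists ((rnorm l)^-1%:C *: l) => [|y].
  by rewrite rnormZr ger0_norm ?invr_ge0 ?rnorm_ge0 // mulVf.
by rewrite !hinnerZr lv.
Qed.

Lemma adj_pairB l l' v v' : adj_pair l v -> adj_pair l' v' ->
  adj_pair (l - l') (v - v').
Proof. by move=> lv lv' y; rewrite !hinnerBr lv lv'. Qed.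

Lemma adj_pair_ket f : Cc f -> adj_pair (L2_q L f) (ket mu z f).
Proof. by move=> Cf y; rewrite hinner_bra2. Qed.

(** Approximate l by q f_n.  The vectors ket f_n form a Cauchy sequence, because the
    differences of adjoint pairs are adjoint pairs and these are bounded; the
    relation passes to the limit. *)
Lemma adj_pair_total l : exists v, adj_pair l v.
Proof.
have [C0 CP0] := adj_pair_bounded; pose C := `|C0| + 1.
have C1 : 0 < C by rewrite ltr_wpDl.
have CP l' v : adj_pair l' v -> rnorm v <= C * rnorm l'.
  move=> /CP0/le_trans; apply; rewrite ler_wpM2r ?rnorm_ge0 //.
  by rewrite (le_trans (ler_norm C0)) // lerDl.
have near_l n : exists g : G -> A, Cc g /\ rnorm (l - L2_q L g) < n.+1%:R^-1.
  have [|g Cg lg] := @L2_dense l n.+1%:R^-1; first by rewrite invr_gt0.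
  by exists g.
have [f fP] := choice near_l.
have small (k e : R) : 0 <= k -> 0 < e -> exists n : nat, k * n.+1%:R^-1 < e.
  move=> k0 e0; exists (Num.truncn (k / e)).
  by rewrite ltr_pdivrMr ?ltr0n // mulrC -ltr_pdivrMr // truncnS_gt.
have [n m nm|e e0|v vP] := @complete_seq R E (fun n => ket mu z (f n))
    (fun n => C * 2 * n.+1%:R^-1).
- have := CP _ _ (adj_pairB (adj_pair_ket (fP m).1) (adj_pair_ket (fP n).1)).
  move/le_trans; apply; rewrite -mulrA ler_pM2l //.
  apply: (le_trans (rnorm_dist _ l _)).
  rewrite mulrDl !mul1r; apply: lerD; last exact: ltW (fP n).2.
  rewrite rnormB (le_trans (ltW (fP m).2)) //.
  by rewrite lef_pV2 ?posrE ?ltr0n // ler_nat.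
- by apply: small => //; rewrite mulr_ge0 // ltW.
exists v => y; apply/eqP; rewrite -subr_eq0; apply/eqP/rnorm_eq0/le_anti.
rewrite rnorm_ge0 andbT; apply/ler_addgt0Pr => e e0; rewrite add0r.
pose k := 6 * (rnorm y * (C * 2)) + 6 * rnorm (bra2 L z y).
have k0 : 0 <= k by rewrite addr_ge0 // !mulr_ge0 ?rnorm_ge0 // ltW.
have [n nk] := small k e k0 e0.
apply: le_trans (ltW nk).
apply: (le_trans (rnorm_dist _ <{y | ket mu z (f n)}> _)).
rewrite [X in _ + rnorm (X - _)](adj_pair_ket (fP n).1) -!hinnerBr /k mulrDl.
apply: lerD; apply: (le_trans (rnorm_hinner _ _)).
  by rewrite -!mulrA ler_pM2l // ler_wpM2l ?rnorm_ge0 // !mulrA.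
rewrite -mulrA ler_pM2l // ler_wpM2l ?rnorm_ge0 // rnormB ltW //.
exact: (fP n).2.
Qed.

Lemma ket2P : adjoint_of (ket2 L z) (bra2 L z) /\
  forall f, Cc f -> ket2 L z (L2_q L f) = ket mu z f.
Proof.
have [T TP] := choice adj_pair_total.
apply: (@xgetI _ _ [set T : L -> E | adjoint_of T (bra2 L z) /\
    forall f : G -> A, Cc f -> T (L2_q L f) = ket mu z f] T).
split=> [l y|f Cf]; first by rewrite -hinner_star TP hinner_star.
by apply: hinner_inj => y; rewrite TP hinner_bra2.
Qed.

Lemma ket2_adj l y : <{ket2 L z l | y}> = <{l | bra2 L z y}>.
Proof. exact: ket2P.1. Qed.

Lemma bra2_adj l y : <{bra2 L z y | l}> = <{y | ket2 L z l}>.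
Proof. by rewrite -[LHS]hinner_star -ket2_adj hinner_star. Qed.

(** Take adjoints in the equivariance of bra2: on vectors gamma_r y both sides
    have the inner product alpha_r <y | ket2 l>. *)
Lemma ket2_gamma r l : ket2 L z (gamma L r l) = gamma E r (ket2 L z l).
Proof.
apply: (@gamma_sep _ _ _ _ _ r) => y.
by rewrite -bra2_adj bra2_gamma !gamma_inner bra2_adj.
Qed.

End SquareIntegrableVector.

Theorem proposition6 (R : realType) (G : lchGroupType)
    (mu : {measure set (borel_type G) -> \bar R}) (mu_haar : left_haar mu)
    (A : cstarAlgType R) (S : twisted_system G A)
    (L : L2_module mu S) (E : twisted_module S)
    (zeta : E) (zeta_si : square_integrable L zeta) :
  is_twisted_morphism (bra2 L zeta) /\ is_twisted_morphism (ket2 L zeta).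
Proof.
split; split.
- by exists (ket2 L zeta) => y l; exact: bra2_adj.
- by move=> r y; exact: bra2_gamma.
- by exists (bra2 L zeta) => l y; exact: ket2_adj.
- by move=> r l; exact: ket2_gamma.
Qed.
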